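(* Let $q=p^h$ be a prime power ($p$ prime, $h\ge 1$) and let $k$ be an algebraically closed field of characteristic zero. Let $C\le PGL_2(q)$ be a Singer cycle and $S\le PGL_2(q)$ the stabilizer of a point of the projective line $\mathbb P^1(\mathbb F_q)$ under the natural action, so that $PGL_2(q)=CS$ with $C\cap S=1$. Let $H_q=k^C\# kS$ be the associated bismash product. Then $H_q$ is not isomorphic, as a $k$-algebra, to a group algebra $kG$ of any finite group $G$, except when $q=2$ or $q=3$.
   Context: A factorized group $(G,L,F)$ is a finite group $G$ with subgroups $L,F$ such that $L\cap F=1$ and $G=LF$. Then every product $lf$ ($l\in L$, $f\in F$) can be written uniquely as $lf=({}^{[l]}f)(l^{[f]})$ with ${}^{[l]}f\in F$ and $l^{[f]}\in L$; this defines a left action of $L$ on $F$ and a right action $l\mapsto l^{[f]}$ of $F$ on $L$. The bismash product $k^L\# kF$ is the vector space $k^L\otimes kF$ with basis $l\# f$ ($l\in L$, $f\in F$, where $l$ stands for the dual basis element of $k^L$ indexed by $l$), with multiplication $(l\# f)(\bar l\#\bar f)=\delta_{l^{[f]},\bar l}\, l\#(f\bar f)$, unit $\sum_{l\in L} l\# 1$, comultiplication $\Delta(l\# f)=\sum_{\hat l\in L}(l\hat l^{-1}\#{}^{[\hat l]}f)\otimes(\hat l\# f)$, counit $\varepsilon(l\# f)=\delta_{l,1}$ and antipode $S(l\# f)=(l^{[f]})^{-1}\#({}^{[l]}f)^{-1}$. A Singer cycle in $PGL_2(q)$ is the image of a cyclic subgroup of $GL_2(q)$ of order $q^2-1$;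 it has order $q+1$ and acts regularly on $\mathbb P^1(\mathbb F_q)$. The bismash product $H_q$ is built from the factorized group $(PGL_2(q),C,S)$ and has dimension $q(q-1)(q+1)$; its isomorphism class does not depend on the choice of $C$ and $S$. *)

(* Defs.v *)
From HB Require Import structures.
From mathcomp Require Import all_boot all_order all_algebra all_fingroup all_solvable.

Set Implicit Arguments.
Unset Strict Implicit.
Unset Printing Implicit Defensive.

Import GRing.Theory.
Local Open Scope ring_scope.

(* Elements of k^L # kF are k-valued functions on the basis            *)
(* {l # f | l in L, f in F}; multiplication is the bilinear extension  *)
(* of (l # f)(l' # f') = delta_{l^[f], l'} l # (f f'), unit sum_l l#1. *)
Section Bismash.
Variables (gT : finGroupType) (L F : {set gT}) (k : fieldType).

(* the decomposition x = f' * l' with f' in F, l' in L (unique when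
   (G,L,F) is a factorized group) *)
Definition fact_dec (x : gT) : option (gT * gT) :=
  [pick p : gT * gT | [&& p.1 \in F, p.2 \in L & (p.1 * p.2)%g == x]].

(* left action  ^[l] f  and right action  l^[f]  defined by
   l f = (^[l] f) (l^[f]) *)
Definition lactF (l f : gT) : gT :=
  if fact_dec (l * f)%g is Some p then p.1 else 1%g.
Definition ractL (l f : gT) : gT :=
  if fact_dec (l * f)%g is Some p then p.2 else 1%g.

Definition bidx : finType := ({l : gT | l \in L} * {f : gT | f \in F})%type.

Definition bismash_mul (x y : {ffun bidx -> k}) : {ffun bidx -> k} :=
  [ffun p : bidx => \sum_(a : bidx) \sum_(b : bidx)
     (if [&& a.1 == p.1, val b.1 == ractL (val a.1) (val a.2)
           & (val a.2 * val b.2)%g == val p.2]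
      then x a * y b else 0)%R].

Definition bismash_one : {ffun bidx -> k} :=
  [ffun p : bidx => if val p.2 == 1%g then 1%R else 0%R].

End Bismash.

Section GroupAlgebra.
Variables (k : fieldType) (G : finGroupType).

Definition galg_mul (x y : {ffun G -> k}) : {ffun G -> k} :=
  [ffun g : G => \sum_(a : G) \sum_(b : G)
     (if (a * b)%g == g then x a * y b else 0)%R].

Definition galg_one : {ffun G -> k} :=
  [ffun g : G => if g == 1%g then 1%R else 0%R].

End GroupAlgebra.

Definition kalg_iso (k : fieldType) (A B : finType)
  (mulA : {ffun A -> k} -> {ffun A -> k} -> {ffun A -> k}) (oneA : {ffun A -> k})
  (mulB : {ffun B -> k} -> {ffun B -> k} -> {ffun B -> k}) (oneB : {ffun B -> k})
  : Prop :=
  exists phi : {ffun A -> k} -> {ffun B -> k},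
    [/\ bijective phi,
        forall x y : {ffun A -> k}, phi (x + y)%R = (phi x + phi y)%R,
        forall (c : k) (x : {ffun A -> k}), phi [ffun i => (c * x i)%R] = [ffun j => (c * phi x j)%R],
        forall x y : {ffun A -> k}, phi (mulA x y) = mulB (phi x) (phi y)
      & phi oneA = oneB].

Definition scalarsGL (F : finFieldType) : {set {'GL_2[F]}} :=
  [set g : {'GL_2[F]} | is_scalar_mx (GLval g)].

Definition PGL2 (F : finFieldType) : finGroupType := coset_of (scalarsGL F).

Definition singer_cycle (F : finFieldType) (C : {set PGL2 F}) : Prop :=
  exists K : {group {'GL_2[F]}},
    [/\ cyclic K, #|K| = (#|F| ^ 2 - 1)%N & C = (K / scalarsGL F)%g].

Definition point_stabilizer (F : finFieldType) (S : {set PGL2 F}) : Prop :=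
  exists v : 'rV[F]_2,
    v != 0%R /\
    S = ([set g : {'GL_2[F]} | (v *m GLval g <= v)%MS] / scalarsGL F)%g.

Definition bismash_is_group_algebra (k : fieldType) (gT : finGroupType)
  (L F : {set gT}) : Prop :=
  exists G : finGroupType,
    kalg_iso (@bismash_mul gT L F k) (bismash_one L F k)
             (@galg_mul k G) (galg_one k G).

(* Main.v *)
Require Import Defs.
From HB Require Import structures.
From mathcomp Require Import all_boot all_order all_algebra all_fingroup all_solvable.
From mathcomp Require Import all_field all_character zify ring.

(** As an algebra, the bismash product is the groupoid algebra of the right
    action of [S] on the [q + 1] points of [C].  This action fixes one point and
    [S] is the affine group [AGL_1(q)], so [H_q] has the matrix blocks of degrees
    [1] ([q - 1] times), [q - 1] (once) and [q] ([q - 1] times).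

    Degrees are compared over different fields through the trace form: if
    [(e_i)] and [(e^i)] are dual bases, then [sum_ij e_i e_j e^i e^j] is intrinsic
    and acts as [1 / d ^ 2] on a block of degree [d].  In [kG] it is the integral
    element [sum_ab a b a^-1 b^-1] up to a scalar, so a polynomial relation which
    it satisfies over [k] also holds over the algebraic numbers; there, together
    with the number of classes, it determines the degrees of [G].

    Let [q > 3].  An element [z] of order [p] in the centre of a Sylow subgroup
    is a zero of every character of degree [q], so the character [chi] of degree
    [q - 1] has value [-1] at [z], the class of [z] has [q ^ 2 - 1] elements, and
    [G'] is the disjoint union of this class and of [N = ker chi], of order
    [q + 1].  Then [N] is abelian, [G'] is transitive on its nontrivial elements,
    and an involution (in [G'] if [q] is even, modulo [N] in the stabiliser of an
    element of [N] if [q] is odd) gives a contradiction.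

    For [q = 2, 3], let [N] be a group of order 3 or a Klein group: all
    permutations of [N] fixing 1 are automorphisms preserving a nondegenerate
    pairing, so [S] acts on [N] as on [C], and the Fourier transform on [N]
    identifies the group algebra of the semidirect product with [H_q]. *)

Set Implicit Arguments.
Unset Strict Implicit.
Unset Printing Implicit Defensive.

(** * Groups whose derived subgroup is a kernel and one class *)

Section FrobeniusLike.
Local Open Scope group_scope.
Variables (gT : finGroupType) (G N : {group gT}) (z : gT) (q : nat).
Hypotheses (q_gt3 : 3 < q) (oN : #|N| = q.+1) (oG' : #|G^`(1)| = (q * q.+1)%N).
Hypotheses (oG : #|G| = (q.-1 * (q * q.+1))%N) (nNG : N <| G).
Hypotheses (Gz : z \in G) (ocz : #|'C_G[z]| = q).
Hypothesis defG' : forall x, (x \in G^`(1)) = (x \in N) || (x \in z ^: G).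

Let q_gt0 : 0 < q := leq_trans (ltn0Sn 3) q_gt3.

Let sNG' : N \subset G^`(1).
Proof. by apply/subsetP=> x Nx; rewrite defG' Nx. Qed.

Let sG'G : G^`(1) \subset G := der_sub 1 G.

Let sNG : N \subset G := normal_sub nNG.

Let G'z x : x \in G^`(1) -> x \notin N -> x \in z ^: G.
Proof. by rewrite defG' => /orP[->|]. Qed.

(** The order of [x] divides both [q.+1], the order of [N], and [q], the order of the centralizer of
    a conjugate of [z]; these are coprime. *)
Lemma class_fpf a x : a \in z ^: G -> x \in N -> x \in 'C[a] -> x = 1.
Proof.
move=> /imsetP[g Gg ->] Nx Cx; apply/eqP; rewrite -order_eq1 -dvdn1.
have Ca : x \in 'C_G[z ^ g] by rewrite inE (subsetP sNG).
have <- : gcdn q.+1 q = 1%N by apply/eqP; rewrite -addn1 gcdnC gcdnDl gcdn1.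
rewrite dvdn_gcd -{1}oN order_dvdG //= -ocz -(cardJg _ g) conjIg conjGid //.
by rewrite -cent1J order_dvdG.
Qed.

Lemma cent_in_kernel x : x \in N -> x != 1 -> 'C_(G^`(1))[x] \subset N.
Proof.
move=> Nx ntx; apply/subsetP=> a /setIP[G'a Ca]; apply: contraR ntx => N'a.
by apply/eqP/(class_fpf (G'z G'a N'a) Nx); rewrite cent1C.
Qed.

Let oN1 : #|N^#| = q.
Proof. by have := cardsD1 1 N; rewrite oN group1 => -[]. Qed.

(** By [cent_in_kernel] the centralizer of [x] in G' has at most [q.+1] elements, so the class has
    at least [q], which is all of [N^#]. *)
Lemma kernel_class x : x \in N -> x != 1 -> x ^: G^`(1) = N^#.
Proof.
move=> Nx ntx; apply/eqP; rewrite eqEcard; apply/andP; split.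
  apply/subsetP=> _ /imsetP[u G'u ->]; rewrite 2!inE conjg_eq1 ntx /=.
  by rewrite memJ_norm // (subsetP (normal_norm nNG)) ?(subsetP sG'G).
have := subset_leq_card (cent_in_kernel Nx ntx); rewrite oN oN1 => le_c.
rewrite -index_cent1 -(leq_pmul2l (cardG_gt0 'C_(G^`(1))[x])).
by rewrite Lagrange ?subsetIl // oG' mulnC leq_mul2l le_c orbT.
Qed.

(** The orbit count of [kernel_class] is tight. In particular [N] centralizes each of its elements,
    whence [kernel_abelian]. *)
Lemma kernel_cent x : x \in N -> x != 1 -> 'C_(G^`(1))[x] = N.
Proof.
move=> Nx ntx; apply/eqP; rewrite eqEcard cent_in_kernel //= oN.
rewrite -(leq_pmul2r (_ : 0 < #|G^`(1) : 'C_(G^`(1))[x]|)) //.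
by rewrite Lagrange ?subsetIl // index_cent1 kernel_class // oG' oN1 mulnC.
Qed.

Lemma kernel_abelian : abelian N.
Proof.
apply/centsP=> x Nx y Ny; have [-> | ntx] := eqVneq x 1; first exact: commute_sym (commute1 _).
by move: Ny; rewrite -(kernel_cent Nx ntx) => /setIP[_ /cent1P /commute_sym].
Qed.

Lemma kernel_witness : exists2 x, x \in N & x != 1.
Proof. by apply/trivgPn; rewrite -cardG_gt1 oN; lia. Qed.

Lemma cent1_conj_fix (x a : gT) : (x \in 'C[a]) = (x ^ a == x).
Proof. by rewrite cent1E conjg_fix; apply/eqP/commgP. Qed.

Let nNx a x : a \in G -> x \in N -> x ^ a \in N.
Proof. by move=> Ga Nx; rewrite memJ_norm // (subsetP (normal_norm nNG)). Qed.

(* An involution acting without fixed points on N inverts it, and the product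
   of two such involutions would centralise N. *)
Lemma no_involution : z ^+ 2 = 1 -> False.
Proof.
move=> z2; have [x Nx ntx] := kernel_witness.
have Gz1 a : a \in z ^: G -> a \in G.
  by move=> za; apply: subsetP sG'G _ _; rewrite defG' za orbT.
have z_inv a y : a \in z ^: G -> y \in N -> y ^ a = y^-1.
  move=> za Ny; have a2 : a * a = 1.
    by case/imsetP: za => g Gg ->; rewrite -conjMg -[z * z]/(z ^+ 2) z2 conj1g.
  have Nya := nNx (Gz1 a za) Ny.
  have /eqP : y * y ^ a = 1.
    apply: (class_fpf za); first by rewrite groupM.
    rewrite cent1_conj_fix conjMg -conjgM a2 conjg1.
    by rewrite (centsP kernel_abelian y Ny (y ^ a)).
  by rewrite -eq_invg_mul => /eqP ->.
have zz : z \in z ^: G := class_refl G z.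
(* [N] and [z *: N] together have at most 2(q + 1) elements, fewer than G'. For [u] outside both,
   [u] and [z * u] are again conjugates of [z]. *)
have /subsetPn[u G'u] : ~~ (G^`(1) \subset N :|: z *: N).
  apply: contraL q_gt3 => /subset_leq_card /leq_trans/(_ (leq_card_setU _ _)).
  rewrite card_lcoset oG' oN addnn -mul2n leq_pmul2r // => le_q2.
  by rewrite -leqNgt (leq_trans le_q2).
rewrite inE negb_or => /andP[N'u zN'u]; have zu := G'z G'u N'u.
have zuz : z * u \in z ^: G.
  apply: G'z; first by rewrite groupM // defG' zz orbT.
  apply: contra zN'u => Nzu; apply/lcosetP; exists (z * u) => //.
  by rewrite mulgA -[z * z]/(z ^+ 2) z2 mul1g.
case/eqP: ntx; apply: (class_fpf zuz Nx).
by rewrite cent1_conj_fix conjgM !z_inv ?groupV // invgK.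
Qed.

(** The nontrivial elements of [N] are conjugate and one is an involution, so [N] has exponent 2. An
    element [t] centralizing [x], of order 2 modulo [N], fixes only 1 and [x] in [N]; this bounds
    the order of [N] by 4. *)
Lemma no_odd : odd q -> False.
Proof.
move=> q_odd; have [y0 Ny0 oy0] : {x | x \in N & #[x] = 2}.
  by apply: Cauchy => //; rewrite oN dvdn2 /= q_odd.
have nty0 : y0 != 1 by rewrite -order_gt1 oy0.
have N2 x : x \in N -> x * x = 1.
  have [-> | ntx] := eqVneq x 1; first by rewrite mulg1.
  move=> Nx; have: x \in y0 ^: G^`(1) by rewrite kernel_class // !inE ntx.
  case/imsetP=> g _ ->; apply/eqP; rewrite -[_ * _]/(_ ^+ 2).
  by rewrite -order_dvdn orderJ oy0.
have [x Nx ntx] := kernel_witness.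
have xG : x ^: G = N^#.
  apply/eqP; rewrite eqEsubset -{2}(kernel_class Nx ntx) imsetS // andbT.
  by apply/subsetP=> _ /imsetP[g Gg ->]; rewrite !inE conjg_eq1 ntx nNx.
have oM : (#|'C_G[x]| * q = q.-1 * q.+1 * q)%N.
  have := Lagrange (subsetIl G 'C[x]); rewrite index_cent1 xG oN1 oG => ->.
  by rewrite (mulnC q) mulnA.
have {}oM : #|'C_G[x]| = (q.-1 * q.+1)%N.
  by apply/eqP; rewrite -(eqn_pmul2r q_gt0) oM.
have sNM : N \subset 'C_G[x].
  by rewrite subsetI sNG; apply/subsetP=> y Ny; apply/cent1P/(centsP kernel_abelian).
have nNM : 'C_G[x] \subset 'N(N) := subset_trans (subsetIl _ _) (normal_norm nNG).
(* The quotient has order q - 1, which is even. *)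
have [T MT oT] : {T | T \in 'C_G[x] / N & #[T] = 2}.
  apply: Cauchy => //; rewrite card_quotient // -divgS //= oM oN mulnK // dvdn2.
  by case: (q) q_odd.
have /morphimP[t Nt /setIP[Gt Ct] defT] := MT.
have Nt2 : t * t \in N.
  apply: coset_idr; first by rewrite groupM.
  by rewrite morphM // -defT -[_ * _]/(T ^+ 2) -oT expg_order.
have ntN2 : T != 1 by rewrite -order_gt1 oT.
(* If [t] also fixes [y = x ^ u] with [u] in G' but not in [N], the commutator of [u^-1] and [t^-1]
   is an element of G' centralizing [x], so it lies in [N]: then [T] centralizes [coset N u]. *)
have CNt y : y \in N -> y \in 'C[t] -> y \in [set 1; x].
  move=> Ny Cy; rewrite !inE; have [// | nty] := eqVneq y 1; rewrite /=.
  apply: contraR ntN2 => neqyx.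
  have: y \in x ^: G^`(1) by rewrite kernel_class // !inE nty.
  case/imsetP=> u G'u def_y.
  have N'u : u \notin N.
    apply: contra neqyx => Nu; rewrite def_y conjg_fix; apply/commgP.
    exact: (centsP kernel_abelian).
  have Gu : u \in G := subsetP sG'G u G'u.
  have Nw : [~ u^-1, t^-1] \in N.
    rewrite -(kernel_cent Nx ntx) inE mem_commg ?groupV //=.
    have -> : [~ u^-1, t^-1] = (u * t) * (t * u)^-1.
      by rewrite /commg /conjg !invgK invMg !mulgA.
    rewrite cent1C cent1_conj_fix conjgM (conjgM x u t) -def_y.
    have /eqP -> : y ^ t == y by rewrite -cent1_conj_fix.
    have xt : x ^ t = x by apply/eqP; rewrite -cent1_conj_fix cent1C.
    have -> : y = x ^ (t * u) by rewrite conjgM xt.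
    by rewrite conjgK.
  have Nu : u \in 'N(N) := subsetP (normal_norm nNG) u Gu.
  have cUT : T \in 'C_(G / N)[coset N u].
    have GT : T \in G / N by rewrite defT mem_quotient.
    rewrite inE GT /= -groupV cent1C -groupV; apply/cent1P/commgP.
    rewrite defT -!morphV -?morphR ?groupV //=; apply/eqP.
    exact: coset_id.
  (* Elements of G' outside [N] are all conjugate in [G], so this class has q - 1 elements. As G/N
     has order q(q - 1), the centralizer has odd order [q] and cannot contain the involution [T]. *)
  have clU : coset N u ^: (G / N) = (G^`(1) / N)^#.
    apply/eqP; rewrite eqEsubset; apply/andP; split.
      apply/subsetP=> _ /imsetP[B /morphimP[g Ng Gg ->] ->].
      rewrite -morphJ // 2!inE mem_quotient ?memJ_norm ?(subsetP (der_norm 1 G)) // andbT.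
      by rewrite morphJ //= conjg_eq1; apply: contra N'u => /eqP /coset_idr->.
    apply/subsetP=> V /setD1P[ntV /morphimP[v Nv G'v def_v]].
    have N'v : v \notin N by apply: contra ntV => N_v; rewrite def_v /= coset_id.
    have: v \in u ^: G by rewrite (class_eqP (G'z G'u N'u)) G'z.
    case/imsetP=> g Gg eq_v; have Ng := subsetP (normal_norm nNG) g Gg.
    by rewrite def_v eq_v /= morphJ //= memJ_class ?mem_quotient.
  have oC : #|'C_(G / N)[coset N u]| = q.
    have nG'N : G^`(1) \subset 'N(N) := subset_trans sG'G (normal_norm nNG).
    have := Lagrange (subsetIl (G / N) 'C[coset N u]).
    rewrite index_cent1 clU card_quotient ?normal_norm // -divgS //= oG oN mulnA mulnK //.
    have := cardsD1 1 (G^`(1) / N); rewrite group1 card_quotient // -divgS //=.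
    rewrite oG' oN mulnK // => oG'N; have -> : #|(G^`(1) / N)^#| = q.-1 by rewrite oG'N.
    by rewrite mulnC => /eqP; rewrite eqn_pmul2l; [move/eqP | case: (q) q_gt3 => [|[]]].
  rewrite -order_eq1 -dvdn1.
  have: #[T] %| q by rewrite -oC order_dvdG.
  by rewrite oT dvdn2 q_odd.
have [n Nn] : exists2 n, n \in N & n \notin [set 1; x].
  apply/subsetPn; apply: contraL q_gt3 => /subset_leq_card.
  by rewrite oN cards2 -leqNgt ltnS => /leq_trans; apply; case: (_ != _).
move=> n'1x.
(* The product [m * m ^ t] is fixed by [t]. It is not 1, since [m] is its own inverse and is not
   fixed; so it is [x]. *)
have nt m : m \in N -> m \notin [set 1; x] -> m ^ t = m * x.
  move=> Nm m'1x; have Nmt := nNx Gt Nm.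
  have : m * m ^ t \in [set 1; x].
    apply: CNt; first by rewrite groupM.
    rewrite cent1_conj_fix conjMg -conjgM.
    have -> : m ^ (t * t) = m.
      by apply/conjg_fixP/commgP/(centsP kernel_abelian).
    by rewrite (centsP kernel_abelian m Nm (m ^ t)).
  rewrite !inE => /orP[] /eqP eqm.
    case/negP: m'1x; apply: CNt => //; rewrite cent1_conj_fix.
    by rewrite -(inj_eq (mulgI m)) eqm N2.
  by apply: (mulgI m); rewrite eqm mulgA N2 // mul1g.
have: N \subset [set 1; x] :|: [set n; n * x].
  apply/subsetP=> m Nm; rewrite inE; have [//|/= m'1x] := boolP (m \in [set 1; x]).
  have: n * m \in [set 1; x].
    apply: CNt; first by rewrite groupM.
    rewrite cent1_conj_fix conjMg !nt //.
    by rewrite (centsP kernel_abelian m Nm x) // -!mulgA (mulgA x) N2 // mul1g.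
  rewrite !inE => /orP[] /eqP eqm.
    by rewrite -(inj_eq (mulgI n)) eqm N2 // eqxx.
  by rewrite orbC -(inj_eq (mulgI n)) eqm mulgA N2 // mul1g eqxx.
move/subset_leq_card/leq_trans/(_ (leq_card_setU _ _)); rewrite oN !cards2.
by do 2!case: (_ != _); rewrite leqNgt ltnS (leq_trans _ q_gt3).
Qed.
End FrobeniusLike.

Import Order.TTheory GRing.Theory Num.Theory.
Local Open Scope ring_scope.

(** * Groups with character degrees 1, q - 1 and q *)

Section Degrees.
Variables (gT : finGroupType) (G : {group gT}) (p h : nat).
Let q := (p ^ h)%N.
Hypotheses (p_pr : prime p) (q_gt3 : (3 < q)%N).
Hypothesis oG : #|G| = (q.-1 * (q * q.+1))%N.
Hypothesis irr_deg :
  forall i : Iirr G, 'chi_i 1%g \in [:: 1; q.-1%:R; q%:R].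
Hypothesis nlin : #|[pred i : Iirr G | 'chi_i \is a linear_char]| = q.-1.
Variable j : Iirr G.
Hypothesis degj : forall i : Iirr G, ('chi_i 1%g == q.-1%:R) = (i == j).

Let q_gt0 : (0 < q)%N := leq_trans (ltn0Sn 3) q_gt3.
Let q1_gt0 : (0 < q.-1)%N.
Proof. by case: (q) q_gt3 => [|[]]. Qed.
Let chi := 'chi_j.
Let chi1 : chi 1%g = q.-1%:R.
Proof. by apply/eqP; rewrite degj. Qed.

Let h_gt0 : (0 < h)%N.
Proof. by move: q_gt3; rewrite /q; case: h. Qed.
Let p_q : (p %| q)%N.
Proof. exact: dvdn_exp. Qed.
Let co_p_q1 : coprime p (q.-1 * q.+1).
Proof.
rewrite (coprime_dvdl p_q) // coprimeMr coprimenS andbT.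
by rewrite coprime_sym -{2}(prednK q_gt0) coprimenS.
Qed.

Let oG' : #|(G^`(1))%g| = (q * q.+1)%N.
Proof.
have := Lagrange (der_sub 1 G); rewrite -card_lin_irr nlin oG mulnC => /eqP.
by rewrite eqn_pmul2l // => /eqP.
Qed.

(** A linear character times [chi] is irreducible of degree q - 1, hence equal to [chi]; off G' some
    linear character takes a value other than 1. *)
Lemma irr_vanish_der g : g \notin G^`(1)%g -> chi g = 0.
Proof.
rewrite -cap_cfker_lin_irr => /bigcapP G'g.
have [i lin_i ker_g] : exists2 i : Iirr G, 'chi_i \is a linear_char & g \notin cfker 'chi_i.
  apply/exists_inP; rewrite -negb_forall_in; apply/negP=> /forall_inP kerg.
  by apply: G'g.
have /irrP[k def_k] : 'chi_i * chi \in irr G by rewrite mul_lin_irr ?mem_irr.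
have def_chi : 'chi_i * chi = chi.
  rewrite def_k /chi; congr 'chi_ _; apply/eqP.
  by rewrite -degj -def_k cfunE chi1 lin_char1 ?mul1r.
have /eqP := congr1 (fun phi : 'CF(G) => phi g) def_chi; rewrite cfunE.
rewrite -subr_eq0 -{2}[chi g]mul1r -mulrBl mulf_eq0 subr_eq0 => /orP[]/eqP//.
move: ker_g; rewrite cfkerEirr inE => /eqP + eq1; case.
by rewrite eq1 lin_char1.
Qed.

(** By Burnside's coprimality argument [z] is a zero or lies in the centre of the character. In the
    second case p divides the order of this centre and q divides its index, so p q would divide the
    order of [G], whose p-part is q. *)
Lemma irr_vanish_center z i :
  z \in G -> #[z]%g = p -> coprime q #|z ^: G|%g -> 'chi[G]_i 1%g = q%:R -> 'chi_i z = 0.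
Proof.
move=> Gz oz co_z def_i; apply: coprime_degree_support_cfcenter.
  by rewrite def_i natrK.
have := dvd_irr1_index_center i; rewrite def_i dvdC_nat => q_dv.
apply/negP=> Zz; have p_dv : (p %| #|'Z('chi_i)%CF|)%N by rewrite -oz order_dvdG.
have: (p * q %| #|G|)%N by rewrite -(Lagrange (cfcenter_sub 'chi_i)) dvdn_mul.
rewrite oG mulnCA mulnC dvdn_pmul2l // => /(coprime_dvdr)/(_ co_p_q1).
by rewrite /coprime gcdnn => /eqP p1; have := p_pr; rewrite p1.
Qed.

(** Evaluates the column orthogonality sums below, where the characters of degree [q] contribute
    nothing. *)
Lemma sum_linear_other (R : zmodType) (F : Iirr G -> R) (a b : R) :
  (forall i, 'chi_i \is a linear_char -> F i = a) -> F j = b ->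
  (forall i, 'chi[G]_i 1%g = q%:R -> F i = 0) ->
  \sum_i F i = a *+ q.-1 + b.
Proof.
move=> Fa Fb F0; rewrite (bigID [pred i | 'chi_i \is a linear_char]) /=.
rewrite (eq_bigr (fun=> a)) // sumr_const nlin; congr (_ + _).
have j_nl : 'chi_j \isn't a linear_char.
  apply: contraL q_gt3 => /lin_char1 /eqP; rewrite -/chi chi1 pnatr_eq1 => /eqP.
  by case: (q) => // -[|[|]].
rewrite (bigD1 j) //= Fb big1 ?addr0 // => i /andP[nlin_i neq_ij]; apply: F0.
have := irr_deg i; rewrite !inE degj (negPf neq_ij) /= => /orP[|/eqP//].
by move=> chi_i1; case/negP: nlin_i; rewrite qualifE /= irr_char.
Qed.

Lemma no_group_with_degrees : False.
Proof.
have [P sylP] := Sylow_exists p G; have [sPG pP p'PG] := and3P sylP.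
have p_G : (p %| #|G|)%N by rewrite oG (dvdn_trans p_q) // dvdn_mull // dvdn_mulr.
have ntZ : 'Z(P)%g != 1%g.
  rewrite center_nil_eq1 ?(pgroup_nil pP) //; apply: contraTneq p'PG => ->.
  by rewrite indexg1 p'natE // negbK.
have [z Zz oz] : {z | z \in 'Z(P)%g & #[z]%g = p}.
  apply: Cauchy => //; have [] := pgroup_pdiv (pgroupS (center_sub P) pP) ntZ.
  by [].
have [Pz cPz] := centerP _ _ Zz.
have Gz := subsetP sPG z Pz.
have co_z : coprime q #|z ^: G|%g.
  rewrite coprimeXl // prime_coprime // -p'natE // -index_cent1.
  apply: pnat_dvd p'PG; apply: indexgS; rewrite subsetI sPG.
  by apply/subsetP=> y Py; apply/cent1P/commute_sym/cPz.
(* The abelianization has order q - 1, prime to [p]. *)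
have G'z : z \in G^`(1)%g.
  apply: coset_idr; first exact: (subsetP (der_norm 1 G)).
  have co_p : coprime p q.-1 by move: co_p_q1; rewrite coprimeMr => /andP[].
  apply/eqP; rewrite -order_eq1.
  suff: (#[coset G^`(1) z]%g %| gcdn p q.-1)%N by rewrite (eqP co_p) dvdn1.
  rewrite dvdn_gcd -{1}oz morph_order ?(subsetP (der_norm 1 G)) //=.
  rewrite -nlin card_lin_irr -card_quotient ?der_norm //.
  by rewrite order_dvdG // mem_quotient.
have lin_z i : 'chi[G]_i \is a linear_char -> 'chi_i z = 1.
  move=> lin_i; rewrite -(lin_char1 lin_i); apply/eqP.
  move: G'z; rewrite -cap_cfker_lin_irr => /bigcapP/(_ i lin_i).
  by rewrite cfkerEirr inE.
have z1 : z != 1%g by rewrite -order_gt1 oz prime_gt1.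
have van_z i : 'chi[G]_i 1%g = q%:R -> 'chi_i z = 0 by exact: irr_vanish_center.
(* Orthogonality of the columns of 1 and [z] reads (q - 1) + (q - 1) chi(z) = 0. *)
have chi_z : chi z = -1.
  have := second_orthogonality_relation z (group1 G).
  rewrite class1G inE (negPf z1) mulr0n.
  rewrite (@sum_linear_other _ _ 1 (chi z * q.-1%:R)).
  - move/eqP; rewrite -{1}[q.-1%:R]mul1r -mulrDl mulf_eq0 pnatr_eq0 (gtn_eqF q1_gt0).
    by rewrite orbF addr_eq0 eq_sym eqr_oppLR => /eqP.
  - by move=> i lin_i; rewrite lin_z // lin_char1 // conjC1 mulr1.
  - by rewrite -/chi chi1 conjC_nat.
  by move=> i /van_z->; rewrite mul0r.
(* The norm of the column of [z] is (q - 1) + 1. *)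
have ocz : #|'C_G[z]%g| = q.
  have := second_orthogonality_relation z Gz; rewrite class_refl mulr1n.
  rewrite (@sum_linear_other _ _ 1 1).
  - by move/eqP; rewrite -[X in _ + X]/(1%:R) -natrD eqr_nat addn1 prednK // => /eqP<-.
  - by move=> i lin_i; rewrite lin_z // conjC1 mulr1.
  - by rewrite -/chi chi_z rmorphN rmorph1 mulrNN mulr1.
  by move=> i /van_z->; rewrite mul0r.
have oz_cl : #|(z ^: G)%g| = (q.-1 * q.+1)%N.
  have := Lagrange (subsetIl G 'C[z]%g); rewrite index_cent1 ocz oG mulnCA => /eqP.
  by rewrite eqn_pmul2l // => /eqP.
have chi_cl x : x \in (z ^: G)%g -> chi x = -1.
  by case/imsetP=> g Gg ->; rewrite cfunJ.
pose N := cfker_group chi.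
have N_chi x : (x \in N) = (chi x == q.-1%:R) by rewrite /= cfkerEirr inE -chi1.
have tiNz x : x \in N -> x \notin (z ^: G)%g.
  rewrite N_chi => /eqP chi_x; apply/negP=> /chi_cl/eqP.
  by rewrite chi_x -addr_eq0 natr1 pnatr_eq0.
have sNG' : N \subset (G^`(1))%g.
  apply/subsetP=> x; rewrite N_chi; apply: contraTT => /irr_vanish_der->.
  by rewrite eq_sym pnatr_eq0 -lt0n.
have sclG' : (z ^: G)%g \subset (G^`(1))%g by rewrite class_sub_norm // der_norm.
have cardD : #|(G^`(1))%g :\: (z ^: G)%g| = q.+1.
  rewrite cardsD (setIidPr sclG') oG' oz_cl -mulnBl -{1}(prednK q_gt0) subSnn.
  by rewrite mul1n.
(* Since [chi] is orthogonal to the trivial character and vanishes off G', it sums to 0 on G'. The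
   class of [z] contributes -(q - 1)(q + 1), so the other q + 1 elements contribute (q - 1)(q +
   1). *)
have sum_chi : \sum_(x in (G^`(1))%g :\: (z ^: G)%g) chi x =
               \sum_(x in (G^`(1))%g :\: (z ^: G)%g) q.-1%:R.
  rewrite sumr_const cardD; apply/eqP.
  have j_neq0 : j != 0.
    rewrite eq_sym -degj irr0 cfun1E group1 eq_sym pnatr_eq1.
    by case: (q) q_gt3 => [|[|[|]]].
  have /eqP : '['chi_j, 'chi[G]_0] = 0 by rewrite cfdot_irr (negPf j_neq0).
  rewrite cfdotE mulf_eq0 invr_eq0 pnatr_eq0 -[_ == 0]negbK -lt0n cardG_gt0 /=.
  rewrite (big_setID (G^`(1))%g) /= (setIidPr (der_sub 1 G)).
  rewrite [X in _ + X]big1 ?addr0 => [|x /setDP[_ /irr_vanish_der]]; last first.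
    by rewrite /chi => ->; rewrite mul0r.
  rewrite (eq_bigr chi) => [|x G'x]; last first.
    by rewrite irr0 cfun1E (subsetP (der_sub 1 G)) // conjC1 mulr1.
  rewrite (big_setID (z ^: G)%g) /= (setIidPr sclG') (eq_bigr _ chi_cl).
  by rewrite sumr_const oz_cl mulNrn addrC subr_eq0 natrM mulr_natr.
(* Each of these q + 1 values has absolute value at most q - 1, the degree; the total is attained
   only if all are equal to it. *)
have defN : N = (G^`(1))%g :\: (z ^: G)%g :> {set gT}.
  apply/eqP; rewrite eqEsubset; apply/andP; split.
    by apply/subsetP=> x Nx; rewrite inE tiNz // (subsetP sNG').
  apply/subsetP=> x Dx; rewrite N_chi; apply/eqP.
  apply: (normC_sum_upper _ sum_chi) Dx => y _.
  by rewrite -chi1 char1_ge_norm // irr_char.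
have defG' x : (x \in (G^`(1))%g) = (x \in N) || (x \in (z ^: G)%g).
  rewrite defN inE; have [/(subsetP sclG')-> | _] := boolP (x \in (z ^: G)%g).
    by rewrite orbT.
  by rewrite orbF.
have oN : #|N| = q.+1 by rewrite defN.
have nNG : (N <| G)%g := cfker_normal chi.
have [p2 | p_odd] := even_prime p_pr.
  apply: (no_involution q_gt3 oN oG' oG nNG Gz ocz defG').
  by rewrite -p2 -oz expg_order.
apply: (no_odd q_gt3 oN oG' oG nNG Gz ocz defG').
by rewrite /q oddX p_odd orbT.
Qed.
End Degrees.

(** * Sums of commutators in group algebras *)

Definition conv (R : nzRingType) (G : finGroupType) (x y : {ffun G -> R}) : {ffun G -> R} :=
  [ffun g => \sum_a \sum_b if (a * b)%g == g then x a * y b else 0].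

Definition ncomm (G : finGroupType) (t : G) : nat :=
  (\sum_(a : G) \sum_(b : G) (a * b * a^-1 * b^-1 == t)%g)%N.

(** The element [sum_ab a b a^-1 b^-1 - c] of the group algebra. The base ring is arbitrary, so that
    relations over [int] can be compared with relations over a field. *)
Definition comm_shift (R : nzRingType) (G : finGroupType) (c : nat) : {ffun G -> R} :=
  [ffun t => (ncomm t)%:R - (c * (t == 1%g))%:R].

Lemma sum_if_eq (R : nmodType) (I : finType) (i : I) (F : I -> R) :
  \sum_j (if i == j then F j else 0) = F i.
Proof.
rewrite (bigD1 i) //= eqxx big1 ?addr0 // => j neq_ji.
by rewrite eq_sym (negPf neq_ji).
Qed.

Lemma conv_map (R S : nzRingType) (f : {rmorphism R -> S}) (G : finGroupType)
    (x y : {ffun G -> R}) :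
  [ffun g => f (conv x y g)] = conv [ffun g => f (x g)] [ffun g => f (y g)].
Proof.
apply/ffunP=> g; rewrite !ffunE rmorph_sum; apply: eq_bigr => a _.
rewrite rmorph_sum; apply: eq_bigr => b _; rewrite !ffunE.
by case: ifP => _; rewrite ?rmorph0 ?rmorphM.
Qed.

Lemma comm_shift_map (R S : nzRingType) (f : {rmorphism R -> S}) (G : finGroupType) c :
  [ffun g => f (comm_shift R G c g)] = comm_shift S G c.
Proof. by apply/ffunP=> g; rewrite !ffunE rmorphB !rmorph_nat. Qed.

Lemma irr_norm_sum (gT : finGroupType) (i : Iirr [set: gT]) :
  \sum_(x : gT) 'chi_i x * ('chi_i x)^* = #|gT|%:R.
Proof.
have nz : #|[set: gT]|%:R != 0 :> algC by rewrite pnatr_eq0 -lt0n cardG_gt0.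
have := cfdot_irr i i; rewrite cfdotE eqxx => /(canRL (mulVKf nz)).
by rewrite mulr1 cardsT => <-; apply: eq_bigl => x; rewrite inE.
Qed.

(** * Action of the commutator element in irreducible representations *)

Section RepresentedAlgebra.
Variables (gT : finGroupType) (n : nat).
Local Notation G := [set: gT]%G.
Variable rG : mx_representation algC G n.

Definition rep_fun (x : {ffun gT -> algC}) : 'M[algC]_n := \sum_g x g *: rG g.

Lemma rep_fun_conv x y : rep_fun (conv x y) = rep_fun x *m rep_fun y.
Proof.
transitivity (\sum_a \sum_b (x a * y b) *: rG (a * b)%g).
  rewrite /rep_fun (eq_bigr (fun g => \sum_a \sum_b (if (a * b)%g == g
    then (x a * y b) *: rG g else 0))) => [|g _]; last first.
    rewrite ffunE scaler_suml; apply: eq_bigr => a _; rewrite scaler_suml.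
    by apply: eq_bigr => b _; case: ifP; rewrite ?scale0r.
  rewrite exchange_big; apply: eq_bigr => a _; rewrite exchange_big.
  by apply: eq_bigr => b _; rewrite sum_if_eq.
rewrite mulmx_suml; apply: eq_bigr => a _; rewrite mulmx_sumr.
by apply: eq_bigr => b _; rewrite repr_mxM ?inE // -scalemxAl -scalemxAr scalerA.
Qed.

Lemma rep_fun_comm (c : nat) :
  rep_fun (comm_shift algC gT c) =
  \sum_a \sum_b rG (a * b * a^-1 * b^-1)%g - (c%:R)%:M.
Proof.
rewrite /rep_fun (eq_bigr (fun g => \sum_a \sum_b (if (a * b * a^-1 * b^-1)%g == g
    then rG g else 0) - (if 1%g == g then c%:R *: rG g else 0))) => [|g _].
  rewrite sumrB sum_if_eq repr_mx1 scalemx1; congr (_ - _).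
  rewrite exchange_big; apply: eq_bigr => a _; rewrite exchange_big.
  by apply: eq_bigr => b _; rewrite sum_if_eq.
rewrite ffunE scalerBl; congr (_ - _).
  rewrite /ncomm natr_sum scaler_suml; apply: eq_bigr => a _.
  rewrite natr_sum scaler_suml; apply: eq_bigr => b _.
  by case: eqP => _; rewrite ?scale1r ?scale0r.
by rewrite eq_sym; case: eqP => _; rewrite ?muln1 // muln0 scale0r.
Qed.

Hypothesis irrG : mx_irreducible rG.

Lemma irr_central_scalar (A : 'M_n) :
  (forall g, A *m rG g = rG g *m A) -> A = (\tr A / n%:R)%:M.
Proof.
move=> cA; have /mx_irrP[n_gt0 _] := irrG.
have /is_scalar_mxP[a ->] : is_scalar_mx A.
  move/groupC: (irrG) => absG; apply: mx_abs_irr_cent_scalar absG _ _.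
  apply/centgmxP => g _.
  exact: cA.
by rewrite mxtrace_scalar -[a *+ n]mulr_natr mulfK // pnatr_eq0 -lt0n.
Qed.

(** By Schur's lemma the conjugates of [rG b] sum to the scalar [#|gT| * \tr (rG b) / n]. There
    remains a multiple of the sum of [\tr (rG b) *: rG b^-1], which is central and has trace [#|gT|]
    because the character has norm 1. *)
Lemma irr_sum_comm :
  \sum_a \sum_b rG (a * b * a^-1 * b^-1)%g = ((#|gT|%:R / n%:R) ^+ 2)%:M.
Proof.
have /mx_irrP[n_gt0 _] := irrG.
have nz : n%:R != 0 :> algC by rewrite pnatr_eq0 -lt0n.
have rM a b : rG (a * b)%g = rG a *m rG b by rewrite repr_mxM ?inE.
have sumConj (B : 'M_n) :
    \sum_a rG a *m B *m rG a^-1%g = (#|gT|%:R * \tr B / n%:R)%:M.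
  rewrite [LHS]irr_central_scalar.
    congr ((_ / _)%:M); rewrite raddf_sum /= (eq_bigr (fun=> \tr B)).
      by rewrite sumr_const mulr_natl.
    by move=> a _; rewrite -mulmxA mxtrace_mulC -mulmxA -rM mulVg repr_mx1 mulmx1.
  move=> g; rewrite mulmx_suml mulmx_sumr (reindex_inj (mulgI g)).
  apply: eq_bigr => a _; rewrite invMg !rM -!mulmxA -rM mulVg.
  by rewrite repr_mx1 mulmx1.
rewrite exchange_big.
transitivity (\sum_b (#|gT|%:R * \tr (rG b) / n%:R) *: rG b^-1%g).
  apply: eq_bigr => b _; rewrite -mul_scalar_mx -sumConj mulmx_suml.
  by apply: eq_bigr => a _; rewrite !rM.
rewrite [LHS]irr_central_scalar => [|g]; last first.
  rewrite mulmx_suml mulmx_sumr [RHS](reindex_inj (@conjg_inj _ g)).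
  apply: eq_bigr => b _; rewrite -scalemxAl -scalemxAr -conjVg -!rM -conjgC.
  congr ((_ * _ / _) *: _).
  rewrite /conjg !rM mxtrace_mulC -mulmxA -rM mulgV.
  by rewrite repr_mx1 mulmx1.
congr (_%:M); rewrite raddf_sum /= expr2 mulrA; congr (_ / _).
have [i def_i] : exists i : Iirr G, cfRepr rG = 'chi_i.
  by apply/irrP; apply/irr_reprP; exists (Representation rG).
have chiE g : \tr (rG g) = 'chi_i g by rewrite -def_i cfunE inE mulr1n.
rewrite (eq_bigr (fun b => #|gT|%:R / n%:R * ('chi_i b * ('chi_i b)^*))); last first.
  by move=> b _; rewrite mxtraceZ !chiE irr_inv mulrA; congr (_ * _); rewrite mulrAC.
rewrite -mulr_sumr; congr (_ * _).
exact: irr_norm_sum.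
Qed.

Lemma irr_comm_shift (c : nat) :
  rep_fun (comm_shift algC gT c) = ((#|gT|%:R / n%:R) ^+ 2 - c%:R)%:M.
Proof. by rewrite rep_fun_comm irr_sum_comm raddfB. Qed.
End RepresentedAlgebra.

(** Mapped to [algC] and into an irreducible representation, the three factors become scalars, one
    of which must be zero. *)
Lemma comm_annihilated_degree (gT : finGroupType) (i : Iirr [set: gT]) (c1 c2 c3 : nat) :
  conv (conv (comm_shift int gT c1) (comm_shift int gT c2)) (comm_shift int gT c3) = 0 ->
  (#|gT|%:R / 'chi_i 1%g) ^+ 2 \in [:: c1%:R; c2%:R; c3%:R].
Proof.
move/(congr1 (fun x : {ffun gT -> int} => [ffun g => (x g)%:~R : algC])).
rewrite /= !(conv_map intr) !(comm_shift_map intr) => /(congr1 (rep_fun 'Chi_i)).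
have irr_i : mx_irreducible 'Chi_i := socle_irr _.
rewrite !rep_fun_conv !irr_comm_shift // -!scalar_mxM.
rewrite /rep_fun big1 => [|g _]; last by rewrite !ffunE scale0r.
have d_gt0 : (0 < irr_degree (socle_of_Iirr i))%N by have /mx_irrP[] := irr_i.
move/(congr1 mxtrace); rewrite mxtrace_scalar mxtrace0 => /eqP.
rewrite mulrn_eq0 (gtn_eqF d_gt0) /= !mulf_eq0 !subr_eq0 !inE.
by rewrite irr1_degree -orbA.
Qed.

(** Commuting pairs are counted by the sum of the orders of the centralizers of all [a], each order
    being the norm of the column of [a]; summed by rows instead, every character contributes
    [#|gT|]. *)
Lemma ncomm1 (gT : finGroupType) : ncomm (1%g : gT) = (#|gT| * Nirr [set: gT])%N.
Proof.
apply/eqP; rewrite -(eqr_nat algC) natrM /ncomm; apply/eqP.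
transitivity (\sum_(a : gT) \sum_(i : Iirr [set: gT]) 'chi_i a * ('chi_i a)^*).
  rewrite natr_sum; apply: eq_bigr => a _.
  rewrite second_orthogonality_relation ?inE // class_refl mulr1n; congr _%:R.
  rewrite -sum1_card [RHS]big_mkcond; apply: eq_bigr => b _.
  rewrite in_setI inE cent1E -(inj_eq (mulIg b)) mulgKV mul1g.
  by rewrite -(inj_eq (mulIg a)) mulgKV eq_sym; case: eqP.
rewrite exchange_big (eq_bigr (fun=> #|gT|%:R)) => [|i _].
  by rewrite sumr_const card_ord mulr_natr.
exact: irr_norm_sum.
Qed.

(** Here [r] is q - 1. Modulo q the two equations give that q divides [n3 + 1]; the size of the sum
    of squares then forces [n3 + 1] to be q itself. *)
Lemma degree_counts (r n1 n2 n3 : nat) : (1 < r)%N ->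
  (n1 + n2 + n3 = r.*2.+1 -> n1 + n2 * r ^ 2 + n3 * r.+1 ^ 2 = r * (r.+1 * r.+2) ->
   n1 = r /\ n2 = 1)%N.
Proof.
case: r => [|t] // t_gt0; rewrite ltnS in t_gt0.
rewrite -mul2n !expnS !expn0 !muln1 => sum_n sum_sq.
have eq3 : (n3.+1 + t.+2 * (t.+1 * t.+1 + 2 * t.+1) =
            t.+2 * (n3 * t.+2 + n2 * t + 2))%N.
  by clear t_gt0; nia.
have [m def_n3] : exists m, (n3.+1 = m * t.+2)%N.
  apply/dvdnP; rewrite -(@dvdn_addl (t.+2 * (t.+1 * t.+1 + 2 * t.+1))) ?dvdn_mulr //.
  by rewrite eq3 dvdn_mulr.
have eq2 : (m * (t * t + 4 * t + 3) + n2 * t = t * t + 5 * t + 3)%N.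
  apply/eqP; rewrite -(eqn_pmul2l (ltn0Sn t.+1)); apply/eqP; move: eq3 def_n3.
  by clear; nia.
have m1 : m = 1%N.
  case: m def_n3 eq2 => [|[|m]] // _ eq2; exfalso; move: eq2 t_gt0; clear.
  by nia.
subst m; have def3 : n3 = t.+1 by lia.
have n2_1 : n2 = 1%N.
  by apply/eqP; rewrite -(eqn_pmul2r t_gt0); apply/eqP; move: eq2; clear; lia.
by split=> //; lia.
Qed.

(** The constants are the squares of the group order divided by 1, q - 1 and q, so these are the
    only possible degrees. The number of commuting pairs says that there are 2q - 1 irreducible
    characters. *)
Lemma no_group_with_comm_relation (gT : finGroupType) (p h : nat) : let q := (p ^ h)%N in
  prime p -> (3 < q)%N -> #|gT| = (q.-1 * (q * q.+1))%N ->
  conv (conv (comm_shift int gT (#|gT| ^ 2)) (comm_shift int gT ((q * q.+1) ^ 2)))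
       (comm_shift int gT ((q.-1 * q.+1) ^ 2)) = 0 ->
  ncomm (1%g : gT) = (#|gT| * (q.*2).-1)%N -> False.
Proof.
move=> q p_pr q_gt3 oG rel; rewrite ncomm1 => /eqP.
have [r def_q] : exists r, q = r.+1 by case: (q) q_gt3 => // r; exists r.
rewrite def_q /= in rel oG q_gt3 *.
rewrite eqn_pmul2l ?oG // => [/eqP oIirr|]; last first.
  by rewrite !muln_gt0 lt0n /= andbT; apply: contraTneq q_gt3 => ->.
pose D (i : Iirr [set: gT]) := irr_degree (socle_of_Iirr i).
have chi1 i : 'chi_i 1%g = (D i)%:R by rewrite irr1_degree.
have r_gt0 : (0 < r)%N by rewrite lt0n; apply: contraTneq q_gt3 => ->.
have degD i : D i \in [:: 1; r; r.+1]%N.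
  have D_gt0 : (0 < D i)%N by rewrite -(ltr_nat algC) -chi1 irr1_gt0.
  have D_eq (e m : nat) : (#|gT|%:R / (D i)%:R) ^+ 2 = (m ^ 2)%:R :> algC ->
      (#|gT| = m * e)%N -> (0 < m)%N -> D i = e.
    move=> + oGm m_gt0; rewrite natrX => /eqP; rewrite eqrXn2 ?divr_ge0 ?ler0n //.
    rewrite -(inj_eq (mulIf (_ : (D i)%:R != 0))) ?pnatr_eq0 -?lt0n // divfK ?pnatr_eq0 -?lt0n //.
    by rewrite -natrM eqr_nat oGm eqn_pmul2l // eq_sym => /eqP.
  have := comm_annihilated_degree i rel; rewrite chi1 !inE.
  case/or3P=> /eqP/D_eq D_i; apply/or3P.
  - by constructor 1; rewrite (D_i 1%N) ?muln1 // oG !muln_gt0 r_gt0.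
  - by constructor 2; rewrite (D_i r) // oG mulnC.
  by constructor 3; rewrite (D_i r.+1) ?muln_gt0 ?r_gt0 // oG mulnA mulnAC.
pose n1 := (\sum_i (D i == 1))%N; pose n2 := (\sum_i (D i == r))%N.
pose n3 := (\sum_i (D i == r.+1))%N.
have r_neq1 : r != 1%N by apply: contraTneq q_gt3 => ->.
have D3 i : ((D i == 1) + (D i == r) + (D i == r.+1) = 1)%N.
  have := degD i; rewrite !inE => /or3P[] /eqP->; rewrite eqxx.
  - by rewrite eq_sym (negPf r_neq1) eqSS eq_sym (gtn_eqF r_gt0).
  - by rewrite (negPf r_neq1) (ltn_eqF (ltnSn r)).
  by rewrite eqSS (gtn_eqF r_gt0) (gtn_eqF (ltnSn r)).
have [n1E n2E] : n1 = r /\ n2 = 1%N.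
  apply: (@degree_counts r n1 n2 n3); first by rewrite ltn_neqAle eq_sym r_neq1.
    rewrite -oIirr -(card_ord (Nirr _)) -sum1_card -!big_split.
    by apply: eq_bigr => i _; apply: D3.
  rewrite -oG; apply/eqP; rewrite -(eqr_nat algC) -cardsT -irr_sum_square.
  apply/eqP; rewrite !big_distrl -!big_split natr_sum; apply: eq_bigr => i _.
  rewrite chi1 -natrX; congr _%:R; rewrite /=.
  have := degD i; rewrite !inE => /or3P[] /eqP->; rewrite eqxx.
  - by rewrite eq_sym (negPf r_neq1) eqSS eq_sym (gtn_eqF r_gt0) !mul0n.
  - by rewrite (negPf r_neq1) (ltn_eqF (ltnSn r)) /= mul1n mul0n addn0.
  by rewrite eqSS (gtn_eqF r_gt0) (gtn_eqF (ltnSn r)) /= mul1n mul0n add0n.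
have linE (i : Iirr [set: gT]) : ('chi_i \is a linear_char) = (D i == 1%N).
  by rewrite qualifE /= irr_char chi1 pnatr_eq1.
have /eqP/sum_nat_eq1[j [_ Dj Dj']] := n2E.
apply: (@no_group_with_degrees gT [set: gT]%G p h p_pr) (j) _ => //; rewrite -/q def_q //=.
- by rewrite cardsT.
- move=> i; rewrite chi1; have := degD i.
  by rewrite !inE !eqr_nat pnatr_eq1.
- rewrite -n1E -sum1_card big_mkcond; apply: eq_bigr => i _.
  by rewrite inE linE; case: eqP.
move=> i; rewrite chi1 eqr_nat.
have [-> | neq_ij] := eqVneq i j; first by move: Dj; case: eqP.
by have := Dj' i neq_ij isT; case: eqP.
Qed.

(** * Groupoid algebras *)

Lemma pchar0_natr_inj (R : idomainType) :
  [pchar R] =i pred0 -> injective (fun n : nat => n%:R : R).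
Proof.
move=> R0 m n; wlog le_mn : m n / (m <= n)%N => [IH | eq_mn].
  by case: (leqP m n) => [/IH// | /ltnW/IH eq_nm /esym/eq_nm].
apply/eqP; rewrite eqn_leq le_mn -subn_eq0 -((pcharf0P _).1 R0) natrB //.
by rewrite eq_mn subrr eqxx.
Qed.

Section FfunLinear.
Variable k : fieldType.

Definition ffun_linear (A B : finType) (f : {ffun A -> k} -> {ffun B -> k}) : Prop :=
  (forall x y : {ffun A -> k}, f (x + y) = f x + f y) /\
  (forall (c : k) (x : {ffun A -> k}), f [ffun i => c * x i] = [ffun j => c * f x j]).

Definition delta (A : finType) (a : A) : {ffun A -> k} := [ffun b => (b == a)%:R].

Lemma sum_delta (A : finType) (a : A) (F : A -> k) : \sum_b F b * delta b a = F a.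
Proof.
rewrite (bigD1 a) //= ffunE eqxx mulr1 big1 ?addr0 // => b neq_ba.
by rewrite ffunE eq_sym (negPf neq_ba) mulr0.
Qed.

Lemma ffun_linear_sum (A B I : finType) (f : {ffun A -> k} -> {ffun B -> k})
    (F : I -> {ffun A -> k}) :
  ffun_linear f -> f (\sum_i F i) = \sum_i f (F i).
Proof.
case=> fD _; have f0 : f 0 = 0 by apply: (addrI (f 0)); rewrite -fD !addr0.
by elim/big_rec2: _ => // i y1 y2 _ <-.
Qed.

Lemma ffun_linear_expand (A B : finType) (f : {ffun A -> k} -> {ffun B -> k}) x b :
  ffun_linear f -> f x b = \sum_a x a * f (delta a) b.
Proof.
move=> lf; have {1}-> : x = \sum_a [ffun i => x a * delta a i].
  apply/ffunP=> i; rewrite sum_ffunE; under eq_bigr do rewrite ffunE.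
  by rewrite sum_delta.
by rewrite ffun_linear_sum // sum_ffunE; apply: eq_bigr => a _; rewrite lf.2 ffunE.
Qed.

Lemma ffun_linear_inv (A B : finType) (f : {ffun A -> k} -> {ffun B -> k}) g :
  ffun_linear f -> cancel f g -> cancel g f -> ffun_linear g.
Proof.
move=> [fD fZ] fK gK; split=> [x y | c x].
  by apply: (can_inj fK); rewrite fD !gK.
by apply: (can_inj fK); rewrite fZ !gK; apply/ffunP=> i; rewrite !ffunE.
Qed.

(** Invariance of the trace under a linear isomorphism, diagonal entries being read off on
    [delta]. *)
Lemma ffun_trace_conj (A B : finType) (f : {ffun A -> k} -> {ffun B -> k}) g
    (T : {ffun A -> k} -> {ffun A -> k}) :
  ffun_linear f -> cancel f g -> cancel g f -> ffun_linear T ->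
  \sum_b f (T (g (delta b))) b = \sum_a T (delta a) a.
Proof.
move=> lf fK gK lT; have lg := ffun_linear_inv lf fK gK.
have lfT : ffun_linear (f \o T).
  by split=> [x y | c x] /=; rewrite ?lT.1 ?lT.2 ?lf.1 ?lf.2.
under eq_bigr => b _ do rewrite (ffun_linear_expand _ _ lfT).
rewrite exchange_big; apply: eq_bigr => a _.
rewrite -[in RHS](fK (T _)) (ffun_linear_expand _ _ lg).
by apply: eq_bigr => b _; rewrite mulrC.
Qed.

End FfunLinear.

Lemma convE (R : nzRingType) (G : finGroupType) (x y : {ffun G -> R}) g :
  conv x y g = \sum_a x a * y (a^-1 * g)%g.
Proof.
rewrite ffunE; apply: eq_bigr => a _.
rewrite -(sum_if_eq (a^-1 * g)%g (fun b => x a * y b)).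
by apply: eq_bigr => b _; rewrite (can2_eq (mulKg a) (mulKVg a)) eq_sym.
Qed.

Lemma sum_conv (R : nzRingType) (G : finGroupType) (x y : {ffun G -> R}) (f : G -> R) :
  \sum_g conv x y g * f g = \sum_a \sum_b x a * y b * f (a * b)%g.
Proof.
under eq_bigr => g _ do rewrite convE mulr_suml.
rewrite exchange_big; apply: eq_bigr => a _.
by rewrite (reindex_inj (mulgI a)); apply: eq_bigr => b _; rewrite mulKg.
Qed.

Lemma conv4 (R : nzRingType) (G : finGroupType) (x y z w : {ffun G -> R}) t :
  conv (conv (conv x y) z) w t = \sum_(u : G * G * G)
    x u.1.1 * y u.1.2 * z u.2 * w ((u.1.1 * u.1.2 * u.2)^-1 * t)%g.
Proof.
rewrite convE (sum_conv _ _ (fun g => w (g^-1 * t)%g)).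
under eq_bigr => g _ do under eq_bigr => c _ do rewrite -mulrA.
under eq_bigr => g _ do rewrite -mulr_sumr.
rewrite (sum_conv _ _ (fun g => \sum_c z c * w ((g * c)^-1 * t)%g)).
rewrite -(pair_big xpredT xpredT (fun v c => x v.1 * y v.2 * z c * w ((v.1 * v.2 * c)^-1 * t)%g)).
rewrite -(pair_big xpredT xpredT (fun a b => \sum_c x a * y b * z c * w ((a * b * c)^-1 * t)%g)).
apply: eq_bigr => a _; apply: eq_bigr => b _.
by rewrite mulr_sumr; apply: eq_bigr => c _; rewrite mulrA.
Qed.

Section Groupoid.
Variables (X : finType) (S : finGroupType) (act : X -> S -> X).

(** Convolution on the action groupoid: [(x, h)] is an arrow from [x] to [act x h], and arrows
    compose from left to right. *)
Definition gpd_mul (k : fieldType) (x y : {ffun X * S -> k}) : {ffun X * S -> k} :=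
  [ffun p => \sum_h x (p.1, h) * y (act p.1 h, h^-1 * p.2)%g].

Definition gpd_one (k : fieldType) : {ffun X * S -> k} :=
  [ffun p => (p.2 == 1%g)%:R].

(** The analogue of [ncomm] for the vertex group of the groupoid at [x]. *)
Definition stab_comm (x : X) (f : S) : nat :=
  (\sum_(g : S) \sum_(h : S)
    [&& act x g == x, act x h == x & (g * h * g^-1 * h^-1 == f)%g])%N.

Definition stab_shift (k : fieldType) (c : nat) : {ffun X * S -> k} :=
  [ffun p => (stab_comm p.1 p.2)%:R - (c * (p.2 == 1%g))%:R].

Hypotheses (act1 : forall x, act x 1%g = x).
Hypothesis actM : forall x g h, act x (g * h)%g = act (act x g) h.

Let actK g : cancel (act^~ g) (act^~ g^-1%g).
Proof. by move=> x; rewrite -actM mulgV act1. Qed.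
Let actKV g : cancel (act^~ g^-1%g) (act^~ g).
Proof. by move=> x; rewrite -actM mulVg act1. Qed.

(** * Transport of the commutator element to an isomorphic group algebra *)

Section Transfer.
Variables (k : fieldType) (G : finGroupType).
Hypothesis k0 : [pchar k] =i pred0.
Variable phi : {ffun X * S -> k} -> {ffun G -> k}.
Variable psi : {ffun G -> k} -> {ffun X * S -> k}.
Hypotheses (phiK : cancel phi psi) (psiK : cancel psi phi) (lphi : ffun_linear phi).
Hypothesis phiM : forall x y, phi (gpd_mul x y) = conv (phi x) (phi y).
Hypothesis phi1 : phi (gpd_one k) = delta k (1%g : G).

Local Notation delta := (delta k).
Let s : k := #|S|%:R / #|G|%:R.

Let G_neq0 : #|G|%:R != 0 :> k.
Proof. by rewrite (pcharf0P _).1 // -lt0n -cardsT cardG_gt0. Qed.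

Lemma gpd_mul_linearr (x : {ffun X * S -> k}) : ffun_linear (gpd_mul x).
Proof.
split=> [y z | c y]; apply/ffunP=> p; rewrite !ffunE.
  by rewrite -big_split; apply: eq_bigr => h _; rewrite ffunE mulrDr.
by rewrite mulr_sumr; apply: eq_bigr => h _; rewrite ffunE mulrCA.
Qed.

Lemma gpd_mul_delta (y : {ffun X * S -> k}) z h x f :
  gpd_mul y (delta (z, h)) (x, f) =
  y (x, f * h^-1)%g * (act x (f * h^-1)%g == z)%:R.
Proof.
rewrite ffunE (bigD1 (f * h^-1)%g) //= big1 ?addr0 => [|g neq_g].
  by rewrite ffunE xpair_eqE /= invMg invgK mulgKV eqxx andbT.
rewrite ffunE xpair_eqE /= (negPf (_ : (g^-1 * f)%g != h)) ?andbF ?mulr0 //.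
by apply: contra neq_g => /eqP <-; rewrite invMg invgK mulKVg.
Qed.

(** Left multiplication by [y] has the same trace in both algebras: [#|G|] times the coefficient at
    1 in the group algebra, [#|S|] times the sum of the coefficients at identity arrows in the
    groupoid algebra. *)
Lemma phi_at1 (y : {ffun X * S -> k}) : phi y 1%g = s * \sum_x y (x, 1%g).
Proof.
have := ffun_trace_conj lphi phiK psiK (gpd_mul_linearr y).
rewrite (eq_bigr (fun=> phi y 1%g)) => [|g _]; last first.
  rewrite phiM psiK convE (bigD1 1%g) //= invg1 mul1g ffunE eqxx mulr1.
  rewrite big1 ?addr0 // => a neq_a1; rewrite ffunE.
  by rewrite -[X in _ == X]mul1g (inj_eq (mulIg g)) invg_eq1 (negPf neq_a1) mulr0.
rewrite sumr_const -mulr_natl => eq_tr.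
apply: (mulfI G_neq0); rewrite eq_tr mulrA mulrCA mulfV // mulr1.
rewrite (eq_bigr (fun p : X * S => y (p.1, 1%g))) => [|[x f] _]; last first.
  by rewrite gpd_mul_delta mulgV act1 eqxx mulr1.
rewrite -(pair_big xpredT xpredT (fun x (f : S) => y (x, 1%g))) /= exchange_big.
by rewrite sumr_const mulr_natl.
Qed.

Let s_card : s * #|X|%:R = 1.
Proof.
have := phi_at1 (gpd_one k); rewrite phi1 ffunE eqxx /= => eq1.
rewrite [RHS]eq1; congr (_ * _).
by rewrite -sum1_card natr_sum; apply: eq_bigr => x _; rewrite ffunE eqxx.
Qed.

Lemma card_gpd_group : #|G| = (#|X| * #|S|)%N.
Proof.
apply: (pchar0_natr_inj k0); rewrite natrM.
have /= := congr1 (fun u => u * #|G|%:R) s_card.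
by rewrite mul1r /s mulrAC divfK // mulrC.
Qed.

(* [delta (dual p)] is dual to [delta p] for the trace form, up to [#|S|]. *)
Let dual (p : X * S) : X * S := (act p.1 p.2, p.2^-1)%g.

(** The tensor formed from a pair of dual bases depends only on the bilinear form, so the one formed
    from [delta p] and [delta (dual p)] is carried to [s] times the sum of all g tensor g^-1. *)
Lemma phi_casimir a c :
  \sum_p phi (delta p) a * phi (delta (dual p)) c = s * (c == a^-1)%g%:R.
Proof.
have dual_coef y p : \sum_g phi y g * phi (delta (dual p)) g^-1%g = s * y p.
  have := phi_at1 (gpd_mul y (delta (dual p))); rewrite phiM convE.
  under eq_bigr do rewrite mulg1; move=> ->; congr (_ * _).
  case: p => z f; rewrite /dual /=.
  under eq_bigr do rewrite gpd_mul_delta invgK mul1g (inj_eq (can_inj (actK f))).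
  by rewrite (bigD1 z) //= eqxx mulr1 big1 ?addr0 // => x /negPf->; rewrite mulr0.
have dual_psi p : phi (delta (dual p)) c = s * psi (delta c^-1%g) p.
  rewrite -dual_coef psiK (bigD1 c^-1%g) //= ffunE eqxx mul1r invgK.
  by rewrite big1 ?addr0 // => g neq_g; rewrite ffunE (negPf neq_g) mul0r.
under eq_bigr do rewrite dual_psi mulrCA [phi _ _ * _]mulrC.
rewrite -mulr_sumr -(ffun_linear_expand _ _ lphi) psiK ffunE.
by rewrite -[in RHS](inj_eq invg_inj) invgK eq_sym.
Qed.

Definition gpd_comm : {ffun X * S -> k} := \sum_p \sum_r
  gpd_mul (gpd_mul (gpd_mul (delta p) (delta r)) (delta (dual p))) (delta (dual r)).

(** Two applications of [phi_casimir], one to the sum over [p] and one to the sum over [r]. *)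
Lemma phi_gpd_comm t : phi gpd_comm t = s ^+ 2 * (ncomm t)%:R.
Proof.
rewrite /gpd_comm ffun_linear_sum // sum_ffunE.
transitivity (\sum_(u : G * G * G) s ^+ 2 *
  ((u.2 == u.1.1^-1) && ((u.1.1 * u.1.2 * u.2)^-1 * t == u.1.2^-1))%g%:R).
  transitivity (\sum_p \sum_r \sum_(u : G * G * G)
     (phi (delta p) u.1.1 * phi (delta (dual p)) u.2) *
     (phi (delta r) u.1.2 * phi (delta (dual r)) ((u.1.1 * u.1.2 * u.2)^-1 * t)%g)).
    apply: eq_bigr => p _; rewrite ffun_linear_sum // sum_ffunE; apply: eq_bigr => r _.
    rewrite !phiM conv4; apply: eq_bigr => u _.
    by rewrite -!mulrA; congr (_ * _); rewrite mulrCA.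
  under eq_bigr do rewrite exchange_big.
  rewrite exchange_big; apply: eq_bigr => u _.
  under eq_bigr do rewrite -mulr_sumr phi_casimir.
  by rewrite -mulr_suml phi_casimir mulrACA -natrM mulnb expr2.
rewrite -mulr_sumr; congr (_ * _); rewrite -natr_sum; congr _%:R.
rewrite -(pair_big xpredT xpredT (fun v c =>
  ((c == v.1^-1) && ((v.1 * v.2 * c)^-1 * t == v.2^-1))%g : nat)).
rewrite -(pair_big xpredT xpredT (fun a b =>
  \sum_c ((c == a^-1) && ((a * b * c)^-1 * t == b^-1))%g : nat)%N) /=.
apply: eq_bigr => a _; apply: eq_bigr => b _.
rewrite (bigD1 a^-1%g) //= eqxx big1 ?addn0 => [|c /negPf-> //].
by rewrite /= -(inj_eq (mulgI (a * b * a^-1)%g)) mulKVg eq_sym.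
Qed.

(** For a nonzero product the four arrows must be composable, which forces [p] and [r] to be loops
    at one vertex. *)
Lemma gpd_commE : gpd_comm = [ffun p => (stab_comm p.1 p.2)%:R].
Proof.
apply/ffunP=> -[x f]; rewrite /gpd_comm sum_ffunE ffunE /=.
pose P g h := [&& act x g == x, act x h == x & (g * h * g^-1 * h^-1 == f)%g].
transitivity (\sum_(p : X * S) \sum_(r : X * S)
    ([&& p.1 == x, r.1 == x & P p.2 r.2])%:R : k).
  apply: eq_bigr => -[z g] _; rewrite sum_ffunE; apply: eq_bigr => -[y h] _.
  rewrite /dual /= !gpd_mul_delta ffunE xpair_eqE /= !invgK -!natrM !mulnb.
  congr (nat_of_bool _)%:R; apply/idP/idP.
    case/andP=> /andP[/andP[/andP[/eqP<- /eqP eq_g] /eqP eq_y] /eqP eq_z] /eqP eq_h.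
    rewrite eqxx /P.
    have eq_f : f = (g * h * g^-1 * h^-1)%g.
      by rewrite -[LHS](mulgK (h * g * h^-1)%g) !mulgA eq_g !invMg invgK !mulgA.
    move: eq_y eq_z eq_h; rewrite eq_g eq_f !(mulgKV, mulgK) !actM => eq_y.
    rewrite eq_y => hy; rewrite hy -{1}eq_y actK => eq_xy; move: eq_y hy.
    by rewrite -eq_xy => _ ->; rewrite !eqxx.
  case/and5P => /eqP-> /eqP-> /eqP gx /eqP hx /eqP <-.
  have g'x : act x g^-1%g = x by rewrite -{1}gx actK.
  by rewrite !(mulgKV, mulgK) !actM !(gx, hx, g'x) !eqxx.
rewrite natr_sum.
rewrite -(pair_big xpredT xpredT (fun z g =>
  \sum_(r : X * S) ([&& z == x, r.1 == x & P g r.2])%:R : k)) /=.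
rewrite (bigD1 x) //= [X in _ + X]big1 ?addr0 => [|z /negPf nz]; last first.
  by apply: big1 => g _; apply: big1 => r _; rewrite nz.
apply: eq_bigr => g _; rewrite natr_sum.
rewrite -(pair_big xpredT xpredT (fun y h => ([&& x == x, y == x & P g h])%:R : k)) /=.
rewrite (bigD1 x) //= [X in _ + X]big1 ?addr0 => [|z /negPf nz]; last first.
  by apply: big1 => h _; rewrite nz andbF.
by apply: eq_bigr => h _; rewrite eqxx.
Qed.

Let m2 : k := (#|X| ^ 2)%:R.

Let m2_s2 : m2 * s ^+ 2 = 1.
Proof. by rewrite /m2 natrX -exprMn mulrC s_card expr1n. Qed.

Lemma phi_stab_shift c :
  comm_shift k G (c * #|X| ^ 2) = [ffun t => m2 * phi (stab_shift k c) t].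
Proof.
have -> : stab_shift k c = gpd_comm + [ffun p => - c%:R * gpd_one k p].
  apply/ffunP=> p; rewrite gpd_commE !ffunE natrM mulNr; congr (_ - _).
apply/ffunP=> t; rewrite lphi.1 lphi.2 phi1 !ffunE phi_gpd_comm mulrDr mulrA m2_s2 mul1r.
by rewrite mulNr mulrN -!natrM mulnA (mulnC _ c).
Qed.

(** By [phi_stab_shift] the images are, up to the factor [m2], commutator elements with integer
    coefficients; in characteristic zero their relation over [k] already holds over [int]. *)
Lemma comm_relation_transfer c1 c2 c3 :
  gpd_mul (gpd_mul (stab_shift k c1) (stab_shift k c2)) (stab_shift k c3) = 0 ->
  conv (conv (comm_shift int G (c1 * #|X| ^ 2)) (comm_shift int G (c2 * #|X| ^ 2)))
    (comm_shift int G (c3 * #|X| ^ 2)) = 0.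
Proof.
move=> rel; have convZ (a b : k) (x y : {ffun G -> k}) :
    conv [ffun t => a * x t] [ffun t => b * y t] = [ffun t => a * b * conv x y t].
  apply/ffunP=> t; rewrite convE ffunE convE mulr_sumr.
  by apply: eq_bigr => g _; rewrite !ffunE mulrACA.
have phi0 : phi 0 = 0 by apply: (addrI (phi 0)); rewrite -lphi.1 !addr0.
have intr_inj0 (z : int) : z%:~R = 0 :> k -> z = 0.
  case: z => n; rewrite ?NegzE; first by move/eqP; rewrite ((pcharf0P k).1 k0) => /eqP->.
  by move/eqP; rewrite mulrNz oppr_eq0 ((pcharf0P k).1 k0).
have /ffunP eq_k : [ffun t => (conv (conv (comm_shift int G (c1 * #|X| ^ 2))
    (comm_shift int G (c2 * #|X| ^ 2))) (comm_shift int G (c3 * #|X| ^ 2)) t)%:~R]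
    = 0 :> {ffun G -> k}.
  rewrite !(conv_map intr) !(comm_shift_map intr) !phi_stab_shift !convZ -!phiM rel phi0.
  by apply/ffunP=> t; rewrite !ffunE mulr0.
by apply/ffunP=> t; have := eq_k t; rewrite [LHS]ffunE !ffunE => /intr_inj0.
Qed.

Lemma ncomm1_transfer : ncomm (1%g : G) = (#|X| * \sum_x stab_comm x 1%g)%N.
Proof.
apply: (pchar0_natr_inj k0); have := phi_at1 gpd_comm; rewrite phi_gpd_comm => eq1.
have := congr1 ( *%R m2) eq1; rewrite mulrA m2_s2 mul1r => ->.
rewrite mulrA natrM /m2 natrX expr2 -[X in X * _]mulrA [_ * s]mulrC s_card mulr1 natr_sum.
by congr (_ * _); apply: eq_bigr => x _; rewrite gpd_commE ffunE.
Qed.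
End Transfer.
End Groupoid.

(** * The groupoid of an affine group with one fixed point *)

Section AffineAction.
Variables (X : finType) (S : finGroupType) (act : X -> S -> X).
Hypotheses (act1 : forall x, act x 1%g = x).
Hypothesis actM : forall x g h, act x (g * h)%g = act (act x g) h.
Variables (x0 : X) (V : {group S}) (r : nat).
Let q := r.+1.
Hypotheses (r_gt0 : (0 < r)%N) (fix0 : forall g, act x0 g = x0).
Hypotheses (oS : #|S| = (q * r)%N) (oX : #|X| = q.+1) (oV : #|V| = q).
Hypothesis stab_abelian : forall x g h,
  x != x0 -> act x g = x -> act x h = x -> commute g h.
Hypothesis card_stab : forall x, x != x0 -> #|[pred g | act x g == x]| = r.
Hypothesis ncommE : forall t : S,
  ncomm t = (q ^ 2 * r.-1 * (t \in V) + q ^ 2 * (t == 1%g))%N.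

Lemma stab_comm_fixed t : stab_comm act x0 t = ncomm t.
Proof.
by apply: eq_bigr => g _; apply: eq_bigr => h _; rewrite !fix0 !eqxx.
Qed.

Lemma stab_comm_moved x t : x != x0 -> stab_comm act x t = (r ^ 2 * (t == 1%g))%N.
Proof.
move=> nx0; rewrite /stab_comm -(card_stab nx0).
transitivity (\sum_(g | act x g == x) \sum_(h | act x h == x) (t == 1%g))%N.
  rewrite [RHS]big_mkcond; apply: eq_bigr => g _.
  case: eqP => [gx | _]; last by rewrite big1.
  rewrite [RHS]big_mkcond; apply: eq_bigr => h _; case: eqP => //= hx.
  by rewrite (stab_abelian nx0 gx hx) mulgK mulgV eq_sym.
by rewrite !sum_nat_const mulnA.
Qed.

(** At [x0] the first two factors are multiples of 1_V - q and 1_V, where 1_V is the sum of the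
    elements of [V]; they annihilate each other since the square of 1_V is q 1_V. At any other point
    the vertex group is abelian of order [r], and the third factor vanishes. *)
Lemma affine_relation (k : fieldType) :
  gpd_mul act (gpd_mul act (stab_shift act k ((q * r) ^ 2)) (stab_shift act k (q ^ 2)))
    (stab_shift act k (r ^ 2)) = 0.
Proof.
have act_neq0 x g : x != x0 -> act x g != x0.
  by apply: contra => /eqP eqx0; rewrite -(act1 x) -(mulgV g) actM eqx0 fix0.
apply/ffunP=> -[x f]; rewrite !ffunE /=; have [-> {x} | nx0] := eqVneq x x0; last first.
  rewrite big1 // => h _; rewrite [X in _ * X]ffunE /= stab_comm_moved ?act_neq0 //.
  by rewrite subrr mulr0.
rewrite big1 // => h _; rewrite ffunE /= fix0; apply/eqP; rewrite mulf_eq0; apply/orP; left.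
have shift2 t : stab_shift act k (q ^ 2) (x0, t) = (q ^ 2 * r.-1)%:R * (t \in V)%:R.
  by rewrite ffunE /= stab_comm_fixed ncommE natrD addrK natrM.
have shift1 t : stab_shift act k ((q * r) ^ 2) (x0, t) =
    (q ^ 2 * r.-1)%:R * ((t \in V)%:R - q%:R * (t == 1%g)%:R).
  rewrite ffunE /= stab_comm_fixed ncommE natrD mulrBr -addrA natrM; congr (_ + _).
  apply/eqP; rewrite -opprB eqr_opp mulrA -!natrM -natrB ?leq_mul2r; last first.
    by rewrite orbC expnMn leq_pmulr // expn_gt0 r_gt0.
  rewrite -mulnBl; apply/eqP; congr (_ * _)%:R.
  by rewrite /q; case: (r) r_gt0 => // s _; rewrite expnMn !expnS !expn0; nia.
apply/eqP; transitivity (((q ^ 2 * r.-1)%:R : k) ^+ 2 *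
   \sum_g ((g \in V)%:R - q%:R * (g == 1%g)%:R) * ((g^-1 * h)%g \in V)%:R).
  rewrite mulr_sumr; apply: eq_bigr => g _; rewrite fix0 shift1 shift2.
  by rewrite mulrACA expr2.
rewrite (eq_bigr (fun g => (h \in V)%:R * ((g \in V)%:R - q%:R * (g == 1%g)%:R))).
  rewrite -mulr_sumr sumrB -mulr_sumr -!natr_sum.
  have -> : (\sum_(g : S) (g \in V) = q)%N.
    by rewrite -oV -sum1_card [RHS]big_mkcond; apply: eq_bigr => g _; case: ifP.
  have -> : (\sum_(g : S) (g == 1%g) = 1)%N.
    by rewrite (bigD1 1%g) //= eqxx big1 // => g /negPf->.
  by rewrite mulr1 subrr !mulr0.
move=> g _; have [Vg | nVg] := boolP (g \in V).
  by rewrite groupMl ?groupV // mulrC.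
rewrite sub0r; have [g1 | _] := eqVneq g 1%g; first by rewrite g1 group1 in nVg.
by rewrite mulr0 oppr0 mul0r mulr0.
Qed.

Variables (k : fieldType) (G : finGroupType) (phi : {ffun X * S -> k} -> {ffun G -> k}).
Hypotheses (k0 : [pchar k] =i pred0) (bij_phi : bijective phi) (lphi : ffun_linear phi).
Hypothesis phiM : forall x y, phi (gpd_mul act x y) = conv (phi x) (phi y).
Hypothesis phi1 : phi (gpd_one X S k) = delta k (1%g : G).

Lemma affine_not_group_algebra p h : prime p -> q = (p ^ h)%N -> (3 < q)%N -> False.
Proof.
move=> p_pr def_q q_gt3; have [psi phiK psiK] := bij_phi.
have oG : #|G| = (q.+1 * (q * r))%N.
  by rewrite (card_gpd_group act1 k0 phiK psiK lphi phiM phi1) oX oS.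
apply: (@no_group_with_comm_relation G p h) => //; rewrite -?def_q //=.
- by rewrite oG mulnC (mulnC q) -mulnA.
- have := comm_relation_transfer act1 actM k0 phiK psiK lphi phiM phi1 (affine_relation k).
  rewrite oX oG -!expnMn => rel.
  by rewrite [(q.+1 * _)%N]mulnC.
(* The vertex groups have [q ^ 2 * r] commuting pairs at [x0] and [r ^ 2] at each of the [q] other
   points, in total [q * r * (q + r)], and [q + r] is 2q - 1. *)
rewrite (ncomm1_transfer act1 actM k0 phiK psiK lphi phiM phi1) oX oG -mulnA.
congr (_ * _)%N; rewrite (bigD1 x0) //= (eq_bigr (fun=> (r ^ 2)%N)) => [|x nx0]; last first.
  by rewrite stab_comm_moved // eqxx muln1.
rewrite stab_comm_fixed ncommE group1 eqxx !muln1 sum_nat_const.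
have -> : #|[pred x | x != x0]| = q by rewrite cardC1 oX.
rewrite /q; case: (r) r_gt0 => // s _; rewrite -mul2n !expnS !expn0 /=; nia.
Qed.
End AffineAction.

(** * The affine group *)

(** [P a b] stands for the map sending t to a t + b. As [P] is a total function, the conditions are
    restricted to nonzero [a]. *)
Definition affine_param (F : finFieldType) (S : finGroupType) (P : F -> F -> S) : Prop :=
  [/\ forall s, exists a b, a != 0 /\ s = P a b,
      forall a b a' b', a != 0 -> a' != 0 -> P a b = P a' b' -> a = a' /\ b = b'
    & forall a b a' b', a != 0 -> a' != 0 ->
        (P a b * P a' b')%g = P (a * a') (b + a * b')].

Section AffineParam.
Variables (F : finFieldType) (S : finGroupType) (P : F -> F -> S).
Hypothesis affP : affine_param P.
Let q := #|F|.

Lemma affine_sum (f : S -> nat) :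
  (\sum_s f s = \sum_(a | a != 0%R) \sum_b f (P a b))%N.
Proof.
have [surjP injP _] := affP.
have [A /fin_all_exists[B AB]] := fin_all_exists surjP.
rewrite (reindex_onto (fun p : F * F => P p.1 p.2) (fun s => (A s, B s))); last first.
  by move=> s _; rewrite -(AB s).2.
rewrite pair_big_dep; apply: eq_bigl => -[a b] /=; rewrite andbT.
have [nz eqP_] := AB (P a b).
apply/eqP/idP => [[<- _] // | nza].
by have [<- <-] := injP _ _ _ _ nza nz eqP_.
Qed.

Lemma affine_commutes a a' : a != 0 -> a' != 0 -> commute (P a 0) (P a' 0).
Proof.
have [_ _ PM] := affP; move=> nza nza'.
by rewrite /commute !PM // !mulr0 mulrC.
Qed.

Lemma sum_neq0 : (\sum_(a : F | a != 0%R) 1 = q.-1)%N.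
Proof. by rewrite sum1_card -(cardC1 (0 : F)). Qed.

Lemma affine_card : #|S| = (q * q.-1)%N.
Proof.
rewrite -sum1_card affine_sum -sum_neq0 big_distrr /=.
by apply: eq_bigr => a _; rewrite sum1_card muln1.
Qed.

Definition translations : {set S} := [set P 1 b | b in [set: F]].

Lemma mem_translations a b : a != 0 -> (P a b \in translations) = (a == 1).
Proof.
have [_ injP _] := affP; move=> nza; apply/imsetP/eqP => [[b' _ eqPP] | ->].
  by have [] := injP _ _ _ _ nza (oner_neq0 _) eqPP.
by exists b; rewrite ?inE.
Qed.

Lemma affine1 : P 1 0 = 1%g.
Proof.
have [_ _ PM] := affP; apply: (mulgI (P 1 0)).
by rewrite mulg1 PM ?oner_neq0 // mul1r mulr0 addr0.
Qed.

Fact translations_group_set : group_set translations.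
Proof.
have [_ _ PM] := affP.
apply/group_setP; split; first by rewrite -affine1 mem_translations ?oner_neq0.
move=> _ _ /imsetP[b _ ->] /imsetP[b' _ ->].
by rewrite PM ?oner_neq0 // mulr1 mem_translations ?oner_neq0.
Qed.
Canonical translations_group := Group translations_group_set.

Lemma card_translations : #|translations| = q.
Proof.
have [_ injP _] := affP; rewrite card_imset ?cardsT // => b b' eqP1.
by have [] := injP _ _ _ _ (oner_neq0 _) (oner_neq0 _) eqP1.
Qed.

Lemma linear_count (u w d : F) : (u != 0) || (w != 0) ->
  (\sum_b \sum_b' (b * u + b' * w == d)%R = q)%N.
Proof.
wlog nz_w : u w / w != 0 => [IH | _].
  case/orP=> nz; last by apply: IH; rewrite ?nz ?orbT.
  rewrite exchange_big -[RHS](IH w u nz) ?nz ?orbT //.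
  by apply: eq_bigr => b _; apply: eq_bigr => b' _; rewrite addrC.
rewrite -[RHS](muln1 q) -sum_nat_const; apply: eq_bigr => b _.
rewrite (bigD1 ((d - b * u) / w)) //= divfK // addrC subrK eqxx big1 ?addn0 // => b' neq_b'.
case: eqP => // eq_d; case/eqP: neq_b'.
by rewrite -eq_d addrAC subrr add0r mulfK.
Qed.

(** The commutator of [P a b] and [P a' b'] is the translation by [b * (1 - a') + b' * (a - 1)]. For
    each of the q(q - 2) pairs [(a, a')] other than (1, 1) every translation arises [q] times; the
    pair (1, 1) gives the identity [q ^ 2] times. *)
Lemma affine_ncomm t : ncomm t =
  (q ^ 2 * q.-2 * (t \in translations) + q ^ 2 * (t == 1%g))%N.
Proof.
have [surjP injP PM] := affP.
have [c [d [nzc ->]]] := surjP t; rewrite mem_translations //.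
have -> : (P c d == 1%g) = (c == 1) && (d == 0).
  rewrite -affine1; apply/eqP/andP => [eqPP | [/eqP-> /eqP->] //].
  by have [-> ->] := injP _ _ _ _ nzc (oner_neq0 _) eqPP.
have comm_eq a b a' b' : a != 0 -> a' != 0 ->
  (P a b * P a' b' * (P a b)^-1 * (P a' b')^-1 == P c d)%g =
  (c == 1) && (b * (1 - a') + b' * (a - 1) == d).
  move=> nza nza'; rewrite -(inj_eq (mulIg (P a' b'))) mulgKV.
  rewrite -(inj_eq (mulIg (P a b))) mulgKV !PM ?mulf_neq0 //.
  apply/eqP/andP => [eqPP | [/eqP-> /eqP<-]]; last first.
    by congr P; [rewrite !mul1r mulrC | ring].
  have [||eq_a eq_b] := injP _ _ _ _ _ _ eqPP; rewrite ?mulf_neq0 //.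
  have c1 : c = 1.
    by apply: (mulIf (mulf_neq0 nza nza')); rewrite mul1r [RHS]eq_a; ring.
  split; first exact/eqP.
  rewrite c1 in eq_b; have -> : d = b + a * b' - b' - a' * b by rewrite eq_b; ring.
  by apply/eqP; ring.
rewrite /ncomm affine_sum.
transitivity (\sum_(a | a != 0%R) \sum_(a' | a' != 0%R) \sum_b \sum_b'
    ((c == 1%R) && (b * (1 - a') + b' * (a - 1) == d)%R))%N.
  apply: eq_bigr => a nza; rewrite [RHS]exchange_big; apply: eq_bigr => b _.
  rewrite affine_sum; apply: eq_bigr => a' nza'; apply: eq_bigr => b' _.
  by rewrite comm_eq.
case: (c == 1); last first.
  by rewrite !muln0; apply: big1 => a _; apply: big1 => a' _; apply: big1 => b _; apply: big1.
have gen a a' : (a != 1) || (a' != 1) ->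
    (\sum_b \sum_b' (b * (1 - a') + b' * (a - 1) == d)%R = q)%N.
  by move=> ne1; apply: linear_count; rewrite orbC !subr_eq0 (eq_sym 1).
have card1 : (\sum_(a : F | (a != 0%R) && (a != 1%R)) 1 = q.-2)%N.
  by have := sum_neq0; rewrite (bigD1 1%R) ?oner_neq0 //= => <-.
rewrite (bigD1 1%R) ?oner_neq0 //= (bigD1 1%R) ?oner_neq0 //=.
set s11 := (\sum_b \sum_b' _)%N; set s1 := (\sum_(a' | _) _)%N; set s2 := (\sum_(a | _) _)%N.
have -> : s1 = (q.-2 * q)%N.
  rewrite -card1 big_distrl; apply: eq_bigr => a' /andP[_ ne1].
  by rewrite /= mul1n gen ?ne1 ?orbT.
have -> : s2 = (q.-2 * (q.-1 * q))%N.
  rewrite -card1 -sum_neq0 !big_distrl; apply: eq_bigr => a /andP[_ ne1].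
  by rewrite /= mul1n; apply: eq_bigr => a' _; rewrite /= mul1n gen ?ne1.
have -> : s11 = (q * q * (d == 0%R))%N.
  rewrite -mulnA -sum_nat_const; apply: eq_bigr => b _.
  rewrite -sum_nat_const; apply: eq_bigr => b' _.
  by rewrite !subrr !mulr0 addr0 eq_sym.
have : (1 < q)%N by apply: finNzRing_gt1.
by clear; case: (q) => [|[|s]] // _; case: (d == 0); nia.
Qed.

End AffineParam.

(** * Subgroups of PGL_2 *)

Section PGL2.
Variable F : finFieldType.
Local Notation GL := {'GL_2[F]}.
Local Notation Z := (scalarsGL F).
Let q := #|F|.

Lemma scalarsGLP (g : GL) : reflect (exists c, GLval g = c%:M) (g \in Z).
Proof. by rewrite inE; apply: is_scalar_mxP. Qed.

Fact scalarsGL_group_set : group_set Z.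
Proof.
apply/group_setP; split; first by apply/scalarsGLP; exists 1.
move=> g h /scalarsGLP[c def_g] /scalarsGLP[d def_h]; apply/scalarsGLP.
by exists (c * d); rewrite GL_MxE def_g def_h -scalar_mxM.
Qed.
Canonical scalarsGL_group := Group scalarsGL_group_set.

Lemma GLval_inj (g h : GL) : GLval g = GLval h -> g = h.
Proof. exact: val_inj. Qed.

Lemma scalarsGL_norm (g : GL) : g \in 'N(Z)%g.
Proof.
apply: (subsetP (cent_sub _)); apply/centP => h /scalarsGLP[c def_h].
by apply: GLval_inj; rewrite !GL_MxE def_h scalar_mxC.
Qed.

Definition glmx (M : 'M[F]_2) : GL := insubd (1%g : GL) M.

Lemma GLval_unitmx (g : GL) : GLval g \in unitmx.
Proof. exact: GL_unitmx. Qed.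

Lemma glmxK (M : 'M[F]_2) : M \in unitmx -> GLval (glmx M) = M.
Proof. by move=> Mu; rewrite -[LHS]/(val (glmx M)) insubdK. Qed.

Lemma card_scalarsGL : #|Z| = q.-1.
Proof.
have unit_c (c : F) : c != 0 -> c%:M \in @unitmx F 2.
  by move=> nzc; rewrite unitmxE det_scalar unitfE expf_neq0.
have -> : Z = [set glmx c%:M | c in [set~ (0 : F)]].
  apply/setP=> g; apply/scalarsGLP/imsetP => [[c def_g] | [c]].
    exists c; last by apply: GLval_inj; rewrite -def_g glmxK ?GLval_unitmx.
    rewrite !inE; apply: contraL (GLval_unitmx g) => /eqP c0.
    by rewrite def_g c0 unitmxE det_scalar expr0n unitr0.
  by rewrite !inE => nzc ->; exists c; rewrite glmxK ?unit_c.
rewrite card_in_imset ?cardsC1 // => c d; rewrite !inE => nzc nzd.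
move/(congr1 (fun g : GL => GLval g 0 0)).
by rewrite /= !glmxK ?unit_c // !mxE.
Qed.

Lemma coset_scale (g h : GL) (c : F) :
  GLval g = c *: GLval h -> coset Z g = coset Z h.
Proof.
move=> def_g; apply/rcoset_kercosetP; rewrite ?scalarsGL_norm //.
rewrite mem_rcoset; apply/scalarsGLP; exists c.
rewrite GL_MxE def_g -scalemxAl -GL_MxE mulgV GL_1E scalemx1 //.
Qed.

Lemma coset_eq_scale (g h : GL) :
  coset Z g = coset Z h -> exists c, GLval g = c *: GLval h.
Proof.
move/rcoset_kercosetP => /(_ (scalarsGL_norm g) (scalarsGL_norm h)).
rewrite mem_rcoset => /scalarsGLP[c def_c]; exists c.
rewrite GL_MxE GL_VxE in def_c.
by rewrite -mul_scalar_mx -def_c mulmxKV ?GLval_unitmx.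
Qed.

Section Point.
Variable v : 'rV[F]_2.
Hypothesis nzv : v != 0.

Definition pointGL : {set GL} := [set g : GL | (v *m GLval g <= v)%MS].

Lemma pointGLP (g : GL) : reflect (exists a, v *m GLval g = a *: v) (g \in pointGL).
Proof. by rewrite inE; apply: sub_rVP. Qed.

Fact pointGL_group_set : group_set pointGL.
Proof.
apply/group_setP; split; first by apply/pointGLP; exists 1; rewrite mulmx1 scale1r.
move=> g h /pointGLP[a va] /pointGLP[b vb]; apply/pointGLP; exists (a * b).
by rewrite GL_MxE mulmxA va -scalemxAl vb scalerA.
Qed.
Canonical pointGL_group := Group pointGL_group_set.

Lemma scalars_sub_point : Z \subset pointGL.
Proof.
apply/subsetP=> g /scalarsGLP[c def_g]; apply/pointGLP; exists c.
by rewrite def_g mul_mx_scalar.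
Qed.

Lemma coset_pointGL (g : GL) : (coset Z g \in pointGL / Z)%g = (g \in pointGL).
Proof.
apply/idP/idP => [/morphimP[h _ Th] | Tg]; last exact: mem_quotient.
move/rcoset_kercosetP => /(_ (scalarsGL_norm g) (scalarsGL_norm h)).
case/rcosetP => z Zz ->; rewrite groupM // (subsetP scalars_sub_point) //.
Qed.

Section Frame.
Variable w : 'rV[F]_2.
Hypothesis wNv : ~~ (w <= v)%MS.
Let B : 'M[F]_2 := col_mx v w.

Lemma frame_unit : B \in unitmx.
Proof.
rewrite -row_free_unit -row_leq_rank leqNgt; apply: contra wNv => rB.
have sv : (v <= B)%MS.
  apply/submxP; exists (row_mx 1%:M 0 : 'M_(1, 1 + 1)).
  by rewrite /B (@mul_row_col _ 1 1 1) mul1mx mul0mx addr0.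
have sw : (w <= B)%MS.
  apply/submxP; exists (row_mx 0 1%:M : 'M_(1, 1 + 1)).
  by rewrite /B (@mul_row_col _ 1 1 1) mul1mx mul0mx add0r.
apply: submx_trans sw _.
have [_ <-] := mxrank_leqif_sup sv.
by rewrite eqn_leq mxrankS //= rank_rV nzv.
Qed.

Lemma frame_inj a b a' b' : a *: v + b *: w = a' *: v + b' *: w -> a = a' /\ b = b'.
Proof.
move=> eq_vw; have /eqP : (b - b') *: w + (a - a') *: v = 0.
  by rewrite addrC !scalerBl addrACA -opprD eq_vw subrr.
rewrite addr_eq0 -scaleNr => /eqP eq_w; have eq_b : b = b'.
  apply/eqP; apply: contraR wNv => neq_b; apply/sub_rVP.
  have nzb : b - b' != 0 by rewrite subr_eq0.
  by exists ((b - b')^-1 * - (a - a')); rewrite -scalerA -eq_w scalerA mulVf ?scale1r.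
split=> //; move: eq_vw; rewrite eq_b => /addIr/eqP.
by rewrite -subr_eq0 -scalerBl scaler_eq0 (negPf nzv) orbF subr_eq0 => /eqP.
Qed.

Lemma frame_span (u : 'rV[F]_2) : exists a b, u = a *: v + b *: w.
Proof.
pose x : 'rV[F]_(1 + 1) := u *m invmx B.
exists (lsubmx x 0 0), (rsubmx x 0 0).
transitivity ((row_mx (lsubmx x) (rsubmx x) : 'M_(1, 1 + 1)) *m col_mx v w).
  by rewrite hsubmxK /x mulmxKV ?frame_unit.
by rewrite (@mul_row_col _ 1 1 1) -!mul_scalar_mx -!mx11_scalar.
Qed.

Definition aff_mx (a b : F) : 'M[F]_2 := block_mx 1%:M 0 b%:M a%:M : 'M[F]_(1 + 1).
(** Matrices act on row vectors from the right: this one fixes [v] and sends [w] to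
    [b *: v + a *: w]. *)
Definition affGL (a b : F) : GL := glmx (invmx B *m aff_mx a b *m B).

Lemma affGL_frame a b : a != 0 -> B *m GLval (affGL a b) = col_mx v (b *: v + a *: w).
Proof.
move=> nza; have Bu := frame_unit.
have Mu : aff_mx a b \in unitmx.
  rewrite unitmxE /aff_mx (@det_lblock _ 1 1) det1 mul1r det_scalar1 unitfE //.
rewrite glmxK ?unitmx_mul ?unitmx_inv ?Bu ?Mu // -mulmxA mulKVmx // /aff_mx /B.
rewrite (@mul_block_col _ 1 1 1 1) !mul_scalar_mx scale1r mul0mx addr0 //.
Qed.

Lemma affGL_v a b : a != 0 -> v *m GLval (affGL a b) = v.
Proof.
by move/(affGL_frame b); rewrite (@mul_col_mx _ 1 1) => /(@eq_col_mx _ 1 1)[].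
Qed.

Lemma affGL_w a b : a != 0 -> w *m GLval (affGL a b) = b *: v + a *: w.
Proof.
by move/(affGL_frame b); rewrite (@mul_col_mx _ 1 1) => /(@eq_col_mx _ 1 1)[].
Qed.

Lemma frame_eq (M N : 'M[F]_2) : v *m M = v *m N -> w *m M = w *m N -> M = N.
Proof.
move=> eqv eqw; apply: (can_inj (mulKmx frame_unit)).
by rewrite /B !(@mul_col_mx _ 1 1) eqv eqw.
Qed.

Lemma affGL_M a b a' b' : a != 0 -> a' != 0 ->
  (affGL a b * affGL a' b')%g = affGL (a * a') (b + a * b').
Proof.
move=> nza nza'; apply: GLval_inj; apply: frame_eq.
  by rewrite GL_MxE mulmxA !affGL_v ?mulf_neq0.
rewrite GL_MxE mulmxA !affGL_w ?mulf_neq0 // mulmxDl -!scalemxAl affGL_v // affGL_w //.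
by rewrite scalerDr !scalerA scalerDl addrA.
Qed.

Definition affPGL (a b : F) : PGL2 F := coset Z (affGL a b).

Lemma affPGL_mem a b : a != 0 -> affPGL a b \in (pointGL / Z)%g.
Proof.
by move=> nza; rewrite coset_pointGL; apply/pointGLP; exists 1; rewrite scale1r affGL_v.
Qed.

(** Dividing a representative by its eigenvalue on [v] gives one that fixes [v]. *)
Lemma affPGL_surj s : s \in (pointGL / Z)%g -> exists a b, a != 0 /\ s = affPGL a b.
Proof.
case/morphimP=> g _ /pointGLP[c vg] ->; have [d [e wg]] := frame_span (w *m GLval g).
have inj_g (u : 'rV[F]_2) : u *m GLval g = 0 -> u = 0.
  by move/(congr1 (fun x => x *m invmx (GLval g))); rewrite mulmxK ?mul0mx // GLval_unitmx.
have nzc : c != 0.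
  by apply: contraNneq nzv => c0; apply/eqP/inj_g; rewrite vg c0 scale0r.
have nze : e != 0.
  apply: contraNneq wNv => e0; apply/sub_rVP; exists (d / c); apply/eqP.
  rewrite -subr_eq0; apply/eqP/inj_g.
  by rewrite mulmxBl wg -scalemxAl vg e0 scale0r addr0 scalerA divfK // subrr.
have nzec : e / c != 0 by rewrite mulf_neq0 ?invr_eq0.
exists (e / c), (d / c); split=> //; apply: (@coset_scale _ _ c).
apply: frame_eq; first by rewrite vg -scalemxAr affGL_v.
by rewrite wg -scalemxAr affGL_w // scalerDr !scalerA ![c * _]mulrC !divfK.
Qed.

Lemma affPGL_inj a b a' b' : a != 0 -> a' != 0 ->
  affPGL a b = affPGL a' b' -> a = a' /\ b = b'.
Proof.
move=> nza nza' /coset_eq_scale[c eq_c].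
have c1 : c = 1.
  have := congr1 (mulmx v) eq_c; rewrite -scalemxAr !affGL_v // => /eqP.
  by rewrite -{1}[v]scale1r -subr_eq0 -scalerBl scaler_eq0 (negPf nzv) orbF subr_eq0 => /eqP.
have := congr1 (mulmx w) eq_c; rewrite c1 scale1r !affGL_w //.
by case/frame_inj.
Qed.

Lemma affPGL_M a b a' b' : a != 0 -> a' != 0 ->
  (affPGL a b * affPGL a' b')%g = affPGL (a * a') (b + a * b').
Proof. by move=> nza nza'; rewrite /affPGL -affGL_M // morphM ?scalarsGL_norm. Qed.

Lemma affPGL_param :
  affine_param (fun a b => subg (pointGL / Z)%G (affPGL a b)).
Proof.
split=> [s | a b a' b' nza nza' | a b a' b' nza nza'].
- have [a [b [nza def_s]]] := affPGL_surj (subgP s).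
  by exists a, b; split=> //; apply: val_inj; rewrite /= -def_s sgvalK.
- move/(congr1 (@sgval _ _)) => eq_s; apply: (affPGL_inj nza nza').
  exact: etrans (esym (subgK _ (affPGL_mem b nza)))
           (etrans eq_s (subgK _ (affPGL_mem b' nza'))).
by rewrite -morphM ?affPGL_mem // affPGL_M.
Qed.

(** As [l] carries the line of [v] to that of [w], membership means that [affPGL a b] preserves the
    line of [w]. This yields the stabilizers of the points of the Singer cycle. *)
Lemma affPGL_conj (l : GL) a b : a != 0 -> v *m GLval l = w ->
  (coset Z l * affPGL a b * (coset Z l)^-1 \in pointGL / Z)%g = (b == 0).
Proof.
move=> nza vl; rewrite -morphV ?scalarsGL_norm // -!morphM ?scalarsGL_norm //=.
rewrite coset_pointGL inE !GL_MxE !mulmxA vl affGL_w //.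
have sub_eq (u : 'rV[F]_2) : (u *m GLval (l^-1)%g <= v)%MS = (u <= w)%MS.
  have v_eq : v = w *m GLval (l^-1)%g by rewrite -vl GL_VxE mulmxK ?GLval_unitmx.
  by rewrite {1}v_eq submxMfree // row_free_unit GLval_unitmx.
rewrite sub_eq.
apply/sub_rVP/eqP => [[c] | ->]; last by exists a; rewrite scale0r add0r.
rewrite -[c *: w]add0r -(scale0r v) => /frame_inj[//].
Qed.
End Frame.
End Point.
End PGL2.

(** * Singer cycles as complements of a point stabilizer *)

Section Singer.
Variable F : finFieldType.
Local Notation GL := {'GL_2[F]}.
Local Notation Z := (scalarsGL F).
Let q := #|F|.
Let q_gt1 : (1 < q)%N := finNzRing_gt1 F.

Lemma card_PGL2 : #|PGL2 F| = (q.+1 * (q * q.-1))%N.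
Proof.
have -> : #|PGL2 F| = #|([set: GL] / Z)%g|.
  rewrite -cardsT; congr #|pred_of_set _|; apply/setP=> x; rewrite inE; apply/esym.
  by have [g _ ->] := cosetP x; rewrite mem_quotient ?inE.
have nZ : [set: GL] \subset 'N(Z)%g by apply/subsetP=> g _; apply: scalarsGL_norm.
rewrite card_quotient // -divgS ?subsetT //= card_GL_2 card_scalarsGL -/q.
have r_gt0 : (0 < q.-1)%N by case: (q) q_gt1 => [|[]].
have -> : (q * q.-1 ^ 2 * q.+1 = q.+1 * (q * q.-1) * q.-1)%N by ring.
by rewrite mulnK.
Qed.

Variable v : 'rV[F]_2.
Hypothesis nzv : v != 0.
Local Notation S := (pointGL v / Z)%G.

Lemma exists_frame : exists w : 'rV[F]_2, ~~ (w <= v)%MS.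
Proof.
have /row_subPn[i nwi] : ~~ ((1%:M : 'M[F]_2) <= v)%MS.
  by apply/negP => /mxrankS; rewrite mxrank1 rank_rV nzv.
by exists (row i 1%:M).
Qed.

Lemma card_point_stabilizer : #|S| = (q * q.-1)%N.
Proof.
have [w wNv] := exists_frame; have := affine_card (affPGL_param nzv wNv).
by rewrite card_sub.
Qed.

Lemma card_pointGL : #|pointGL v| = (q * q.-1 * q.-1)%N.
Proof.
have nZ : pointGL v \subset 'N(Z)%g by apply/subsetP=> g _; apply: scalarsGL_norm.
have := card_point_stabilizer; rewrite /= card_quotient // => iT.
by rewrite -(Lagrange (scalars_sub_point v)) card_scalarsGL iT mulnC.
Qed.

Variable K : {group GL}.
Hypotheses (cycK : cyclic K) (oK : #|K| = (q ^ 2 - 1)%N).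

(** Let [l] in [K] have [v] as an eigenvector. If some [g] in [K] moves the line of [v], then [l],
    commuting with [g], has the same eigenvalue on the image of [v], so it is scalar. Otherwise [K]
    stabilizes the line, and comparing orders q + 1 would divide q(q - 1), hence q - 1. *)
Lemma singer_point : K :&: pointGL v \subset Z.
Proof.
apply/subsetP=> l /setIP[Kl /pointGLP[a vl]]; apply: contraT => nZl.
have sKT : K \subset pointGL v.
  apply/subsetP=> g Kg; rewrite inE; apply: contraR nZl => vgNv.
  apply/scalarsGLP; exists a; apply: (frame_eq nzv vgNv); rewrite mul_mx_scalar //.
  have eq_gl : GLval g *m GLval l = GLval l *m GLval g.
    by have := congr1 (@GLval _ _) (centsP (cyclic_abelian cycK) g Kg l Kl).
  by rewrite -mulmxA eq_gl mulmxA vl scalemxAl.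
have := cardSg sKT; rewrite oK card_pointGL -[(q ^ 2)%N]/(q * q)%N.
have -> : (q * q - 1 = q.+1 * q.-1)%N by case: (q) q_gt1 => // s _ /=; lia.
have r_gt0 : (0 < q.-1)%N by case: (q) q_gt1 => [|[]].
rewrite dvdn_pmul2r // Gauss_dvdr ?coprimeSn // => /(dvdn_leq r_gt0).
by rewrite ltnNge leq_pred.
Qed.

Lemma singer_TI : ((K / Z) :&: S = 1)%g.
Proof.
apply/trivgP/subsetP=> _ /setIP[/morphimP[l _ Kl ->] Sl].
rewrite inE; apply/eqP/coset_id; apply: (subsetP singer_point).
by rewrite inE Kl -coset_pointGL.
Qed.

Lemma singer_orbit (l : GL) : l \in K -> coset Z l != 1%g -> ~~ (v *m GLval l <= v)%MS.
Proof.
move=> Kl; apply: contra => vl; apply/eqP/coset_id.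
by apply: (subsetP singer_point); rewrite !inE Kl.
Qed.

(** The upper bound comes from the trivial intersection with [S] inside [PGL2 F], the lower one from
    [K] meeting [Z] in at most q - 1 elements. *)
Lemma card_singer : #|(K / Z)%g| = q.+1.
Proof.
have r_gt0 : (0 < q.-1)%N by case: (q) q_gt1 => [|[]].
have nZ : K \subset 'N(Z)%g by apply/subsetP=> g _; apply: scalarsGL_norm.
have oK' : #|K| = (q.+1 * q.-1)%N.
  by rewrite oK -[(q ^ 2)%N]/(q * q)%N; case: (q) q_gt1 => // s _ /=; lia.
apply/eqP; rewrite eqn_leq; apply/andP; split.
  have := subset_leq_card (subsetT ((K / Z) * S)%g).
  rewrite TI_cardMg ?singer_TI // card_point_stabilizer cardsT card_PGL2.
  by rewrite leq_pmul2r // muln_gt0 r_gt0 ltnW.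
rewrite card_quotient // -(leq_pmul2r r_gt0) -oK' -(LagrangeI K Z) mulnC.
by rewrite leq_mul2l -card_scalarsGL subset_leq_card ?orbT ?subsetIr.
Qed.

Lemma singer_factor : (S * (K / Z) = [set: PGL2 F])%g.
Proof.
apply/eqP; rewrite eqEcard subsetT cardsT card_PGL2 TI_cardMg.
  by rewrite card_point_stabilizer card_singer [X in (_ <= X)%N]mulnC leqnn.
by rewrite setIC singer_TI.
Qed.
End Singer.

(** * Factorized groups *)

Section Factorized.
Variables (gT : finGroupType) (L S : {group gT}).
Hypotheses (tiLS : (L :&: S = 1)%g) (defG : (S * L = [set: gT])%g).

(** Uniqueness of the factorization: the pair picked by [fact_dec] is the given one. *)
Lemma ractL_eq l f f' l' : f' \in S -> l' \in L -> (l * f = f' * l')%g ->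
  ractL L S l f = l'.
Proof.
move=> Sf' Ll' eq_lf; rewrite /ractL /fact_dec.
case: pickP => [[f1 l1] /and3P[/= Sf1 Ll1 /eqP eq1] | /(_ (f', l'))]; last first.
  by rewrite /= Sf' Ll' eq_lf eqxx.
have eqLS : (f'^-1 * f1 = l' * l1^-1)%g.
  by apply: (mulgI f'); apply: (mulIg l1); rewrite mulKVg mulgA mulgKV eq1.
have : (l' * l1^-1 \in L :&: S)%g.
  by rewrite inE groupMl ?groupV // Ll1 -eqLS groupM ?groupV.
by rewrite tiLS inE -eq_mulgV1 => /eqP.
Qed.

Lemma ractL_spec l f : ractL L S l f \in L /\ (l * f * (ractL L S l f)^-1 \in S)%g.
Proof.
have : (l * f)%g \in (S * L)%g by rewrite defG inE.
case/mulsgP=> f' l' Sf' Ll' eq_lf.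
by rewrite (ractL_eq Sf' Ll' eq_lf) eq_lf mulgK.
Qed.

Definition lpoint : finType := {l : gT | l \in L}.

(** By [ractL_spec] the default [x] of [insubd] is never reached. *)
Definition lact (x : lpoint) (g : [subg S]) : lpoint :=
  insubd x (ractL L S (val x) (sgval g)).

Lemma val_lact x g : val (lact x g) = ractL L S (val x) (sgval g).
Proof. by rewrite insubdK //; have [] := ractL_spec (val x) (sgval g). Qed.

Lemma lact1 x : lact x 1%g = x.
Proof.
apply: val_inj; rewrite val_lact; apply: ractL_eq (group1 S) (valP x) _.
by rewrite mulg1 mul1g.
Qed.

Lemma lactM x g h : lact x (g * h)%g = lact (lact x g) h.
Proof.
apply: val_inj; rewrite !val_lact.
have [Lx1 Sx1] := ractL_spec (val x) (sgval g).
have [Lx2 Sx2] := ractL_spec (ractL L S (val x) (sgval g)) (sgval h).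
apply: (ractL_eq _ Lx2); last first.
  apply: (mulIg (ractL L S (ractL L S (val x) (sgval g)) (sgval h))^-1%g).
  rewrite mulgK; reflexivity.
rewrite morphM ?inE //=; set l1 := ractL L S _ _ in Lx1 Sx1 Lx2 Sx2 *.
set l2 := ractL L S l1 _ in Lx2 Sx2 *.
have -> : (val x * (sgval g * sgval h) * l2^-1 =
  (val x * sgval g * l1^-1) * (l1 * sgval h * l2^-1))%g by rewrite !mulgA mulgKV.
exact: groupM.
Qed.

(** [L] represents the right cosets of [S], and the action is right multiplication on these
    cosets. *)
Lemma lact_fix x g : (lact x g == x) = (val x * sgval g * (val x)^-1 \in S)%g.
Proof.
rewrite -val_eqE val_lact; apply/eqP/idP => [eq_x | Sx].
  by have [_] := ractL_spec (val x) (sgval g); rewrite eq_x.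
by apply: ractL_eq Sx (valP x) _; rewrite mulgKV.
Qed.

Variable k : fieldType.
Local Notation X := lpoint.
Local Notation Sg := [subg S].

Definition tosub (g : Sg) : {f : gT | f \in S} := exist _ (sgval g) (subgP g).
Definition ofsub (f : {f : gT | f \in S}) : Sg := subg S (val f).

Lemma tosubK : cancel tosub ofsub.
Proof. by move=> g; rewrite /ofsub /= sgvalK. Qed.
Lemma ofsubK : cancel ofsub tosub.
Proof. by move=> f; apply: val_inj; rewrite /= subgK ?(valP f). Qed.

Definition to_gpd (x : {ffun bidx L S -> k}) : {ffun X * Sg -> k} :=
  [ffun p => x (p.1, tosub p.2)].
Definition of_gpd (y : {ffun X * Sg -> k}) : {ffun bidx L S -> k} :=
  [ffun p => y (p.1, ofsub p.2)].

Lemma to_gpdK : cancel to_gpd of_gpd.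
Proof. by move=> x; apply/ffunP=> -[l f]; rewrite !ffunE /= ofsubK. Qed.
Lemma of_gpdK : cancel of_gpd to_gpd.
Proof. by move=> x; apply/ffunP=> -[l f]; rewrite !ffunE /= tosubK. Qed.

Lemma to_gpd_linear : ffun_linear to_gpd.
Proof. by split=> [x y | c x]; apply/ffunP=> p; rewrite !ffunE. Qed.

(** The Kronecker delta of the bismash product is composability of arrows, so for each [a] a single
    [b] contributes. *)
Lemma to_gpdM x y : to_gpd (bismash_mul x y) = gpd_mul lact (to_gpd x) (to_gpd y).
Proof.
apply/ffunP=> -[l u]; rewrite !ffunE /=.
pose b0 h : bidx L S := (lact l h, tosub (h^-1 * u)%g).
transitivity (\sum_(a : bidx L S) if l == a.1 then x (l, a.2) * y (b0 (ofsub a.2)) else 0).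
  apply: eq_bigr => -[a1 f] _ /=; rewrite [l == a1]eq_sym; case: eqP => [-> | _]; last first.
    by rewrite big1.
  rewrite -(sum_if_eq (b0 (ofsub f)) (fun b => x (l, f) * y b)).
  apply: eq_bigr => -[b1 b2] _ /=; congr (if _ then _ else _).
  rewrite xpair_eqE [_ == b1]eq_sym [_ == b2]eq_sym -!val_eqE val_lact /= !subgK ?(valP f) //.
  by congr (_ && _); rewrite -(inj_eq (mulgI (sval f)^-1%g)) mulKg.
rewrite -(pair_big xpredT xpredT (fun a f => if l == a then x (l, f) * y (b0 (ofsub f)) else 0)) /=.
rewrite exchange_big; under eq_bigr do rewrite sum_if_eq.
rewrite (reindex tosub); last by exists ofsub => g _; rewrite ?tosubK ?ofsubK.
by apply: eq_bigr => g _; rewrite !ffunE tosubK.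
Qed.

Lemma to_gpd1 : to_gpd (bismash_one L S k) = gpd_one X Sg k.
Proof.
apply/ffunP=> p; rewrite !ffunE /= -(inj_eq val_inj).
by case: eqP.
Qed.

Lemma bismash_group_algebraP :
  bismash_is_group_algebra k L S <->
  exists (G : finGroupType) (phi : {ffun X * Sg -> k} -> {ffun G -> k}),
    [/\ bijective phi, ffun_linear phi,
        forall x y, phi (gpd_mul lact x y) = conv (phi x) (phi y)
      & phi (gpd_one X Sg k) = delta k (1%g : G)].
Proof.
have galg1 (G : finGroupType) : galg_one k G = delta k (1%g : G).
  by apply/ffunP=> g; rewrite !ffunE; case: eqP.
have of_linear := ffun_linear_inv to_gpd_linear to_gpdK of_gpdK.
split=> [[G [phi [bij_phi phiD phiZ phiM phi1]]] | [G [phi [bij_phi lphi phiM phi1]]]].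
  exists G, (phi \o of_gpd); split=> [|||] /=.
  - by apply: bij_comp => //; exists to_gpd; [apply: of_gpdK | apply: to_gpdK].
  - by split=> [x y | c x] /=; rewrite ?of_linear.1 ?of_linear.2 ?phiD ?phiZ.
  - move=> x y; rewrite -[gpd_mul _ x y]of_gpdK -{1}(of_gpdK x) -{1}(of_gpdK y).
    by rewrite -to_gpdM !to_gpdK phiM.
  by rewrite -to_gpd1 to_gpdK phi1 galg1.
exists G, (phi \o to_gpd); split=> [||||] /=.
- by apply: bij_comp => //; exists of_gpd; [apply: to_gpdK | apply: of_gpdK].
- by move=> x y; rewrite to_gpd_linear.1 lphi.1.
- by move=> c x; rewrite to_gpd_linear.2 lphi.2.
- by move=> x y; rewrite to_gpdM phiM.
by rewrite to_gpd1 phi1 galg1.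
Qed.
End Factorized.

(** * Semidirect products and the Fourier transform *)

(* The type [S * N] itself already carries the direct product group. *)
Definition semidirect_carrier (S N : Type) : Type := (S * N)%type.
HB.instance Definition _ (S N : finType) := Finite.on (semidirect_carrier S N).

Lemma semidirect_exists (S N : finGroupType) (to : N -> S -> N) :
  (forall n, to n 1%g = n) ->
  (forall n g h, to n (g * h)%g = to (to n g) h) ->
  (forall m n g, to (m * n)%g g = (to m g * to n g)%g) ->
  exists (G : finGroupType) (e : S * N -> G), bijective e /\
    forall g m h n, (e (g, m) * e (h, n))%g = e (g * h, to m h * n)%g.
Proof.
move=> to1 toM toMul.
have toi g : to 1%g g = 1%g by apply: (mulgI (to 1%g g)); rewrite -toMul !mulg1.
pose mul (x y : semidirect_carrier S N) : semidirect_carrier S N :=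
  (x.1 * y.1, to x.2 y.1 * y.2)%g.
pose inv (x : semidirect_carrier S N) : semidirect_carrier S N :=
  (x.1^-1, to x.2^-1 x.1^-1)%g.
have mulA : associative mul.
  by move=> x y z; rewrite /mul /= toMul toM !mulgA.
have mul1 : left_id (1%g, 1%g) mul.
  by case=> g n; rewrite /mul /= toi !mul1g.
have mulr1 : right_id (1%g, 1%g) mul.
  by case=> g n; rewrite /mul /= to1 !mulg1.
have mulV : left_inverse (1%g, 1%g) inv mul.
  by case=> g n; rewrite /mul /inv /= -toM !mulVg to1 mulVg.
have mulrV : right_inverse (1%g, 1%g) inv mul.
  by case=> g n; rewrite /mul /inv /= -toMul !mulgV toi.
pose G : finGroupType := HB.pack (semidirect_carrier S N)
  (isGroup.Build (semidirect_carrier S N) mulA mul1 mulr1 mulV mulrV).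
by exists G, (fun x => x); split; [exists (fun x => x) |].
Qed.

Lemma sum_pairs (R : nmodType) (I J : finType) (F : I * J -> R) :
  \sum_p F p = \sum_i \sum_j F (i, j).
Proof. by rewrite pair_big; apply: eq_bigr => -[]. Qed.

Section FourierTransform.
Variables (k : fieldType) (N : finGroupType) (beta : N -> N -> k).
Hypothesis k0 : [pchar k] =i pred0.
Hypothesis auto_fix1 : forall s : N -> N, injective s -> s 1%g = 1%g ->
  forall x y, s (x * y)%g = (s x * s y)%g.
Hypothesis beta_inv : forall s : N -> N, injective s -> s 1%g = 1%g ->
  forall x y, beta (s x) (s y) = beta x y.
Hypothesis betaC : forall x y, beta x y = beta y x.
Hypothesis betaM : forall x y z, beta x (y * z)%g = beta x y * beta x z.
Hypothesis beta1 : forall x, beta 1%g x = 1.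
Hypothesis beta_sum : forall x, x != 1%g -> \sum_y beta x y = 0.

Variables (X : finType) (S : finGroupType) (act : X -> S -> X).
Hypotheses (act1 : forall x, act x 1%g = x).
Hypothesis actM : forall x g h, act x (g * h)%g = act (act x g) h.
Variables (x0 : X) (b : X -> N) (b' : N -> X).
Hypotheses (fix0 : forall g, act x0 g = x0).
Hypotheses (bK : cancel b b') (b'K : cancel b' b) (bx0 : b x0 = 1%g).

Let actK g : cancel (act^~ g) (act^~ g^-1%g).
Proof. by move=> x; rewrite -actM mulgV act1. Qed.
Let actKV g : cancel (act^~ g^-1%g) (act^~ g).
Proof. by move=> x; rewrite -actM mulVg act1. Qed.

Let N_neq0 : #|N|%:R != 0 :> k.
Proof. by rewrite ((pcharf0P k).1 k0) -lt0n -cardsT cardG_gt0. Qed.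

Let orth x y : \sum_m beta x^-1%g m * beta m y = #|N|%:R * (x == y)%:R.
Proof.
under eq_bigr => m _ do rewrite (betaC _ m) -betaM betaC.
have [-> | neq_xy] := eqVneq x y; last first.
  by rewrite mulr0 beta_sum // -eq_mulVg1.
by rewrite mulVg mulr1; under eq_bigr do rewrite beta1; rewrite sumr_const.
Qed.

Let betaV x y : beta x^-1%g y = beta x y^-1%g.
Proof.
have nz : beta x y != 0.
  apply/eqP=> b0; have := betaM x y y^-1%g.
  by rewrite mulgV betaC beta1 b0 mul0r => /eqP; rewrite oner_eq0.
apply: (mulIf nz); rewrite -betaM mulVg [RHS]betaC beta1.
by rewrite betaC (betaC x) -betaM mulVg betaC beta1.
Qed.

Let orthV x y : \sum_n beta y n * beta n^-1%g x = #|N|%:R * (x == y)%:R.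
Proof.
rewrite -orth; apply: eq_bigr => n _.
by rewrite betaV (betaC n x^-1%g) (betaC y n) mulrC.
Qed.

(** Transported to [N] by [b], the action of [S] is by automorphisms, which gives a semidirect
    product. The Fourier transform in the coordinate of [N] identifies its group algebra with the
    groupoid algebra, and [beta_inv] makes it compatible with the action. *)
Lemma fourier_group_algebra :
  exists (G : finGroupType) (phi : {ffun X * S -> k} -> {ffun G -> k}),
    [/\ bijective phi, ffun_linear phi,
        forall x y, phi (gpd_mul act x y) = conv (phi x) (phi y)
      & phi (gpd_one X S k) = delta k (1%g : G)].
Proof.
pose to n g := b (act (b' n) g).
have to_inj g : injective (to^~ g).
  by move=> m n /(can_inj bK) /(can_inj (actK g)) /(can_inj b'K).
have to_fix g : to 1%g g = 1%g by rewrite /to -bx0 bK fix0.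
have to_b x g : b (act x g) = to (b x) g by rewrite /to bK.
have [|||G [e [[e' eK e'K] eM]]] := @semidirect_exists S N to.
- by move=> n; rewrite /to act1 b'K.
- by move=> n g h; rewrite /to bK actM.
- by move=> m n g; apply: (auto_fix1 (to_inj g) (to_fix g)).
(* The character is taken at the target of the arrow because in [e (f, n)] the factor from [N]
   stands on the right. *)
pose psi (y : {ffun G -> k}) : {ffun X * S -> k} :=
  [ffun p => \sum_n y (e (p.2, n)) * beta (b (act p.1 p.2)) n].
pose phi (x : {ffun X * S -> k}) : {ffun G -> k} :=
  [ffun g => #|N|%:R^-1 * \sum_m beta (e' g).2^-1%g m * x (act (b' m) (e' g).1^-1%g, (e' g).1)].
have phiK : cancel phi psi.
  move=> x; apply/ffunP=> -[l f]; rewrite ffunE /=.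
  transitivity (\sum_n \sum_m #|N|%:R^-1 *
     (beta (b (act l f)) n * beta n^-1%g m * x (act (b' m) f^-1%g, f))).
    apply: eq_bigr => n _; rewrite ffunE eK /= -mulrA mulr_suml mulr_sumr.
    by apply: eq_bigr => m _; congr (_ * _); rewrite mulrC mulrA.
  rewrite exchange_big (bigD1 (b (act l f))) //= [X in _ + X]big1 ?addr0 => [|m neq_m].
    rewrite -mulr_sumr -mulr_suml orthV eqxx mulr1 mulrA mulVf // mul1r.
    by rewrite bK actK.
  by rewrite -mulr_sumr -mulr_suml orthV (negPf neq_m) mulr0 mul0r mulr0.
have psiK : cancel psi phi.
  move=> y; apply/ffunP=> g; rewrite ffunE; case def_g: (e' g) => [f n] /=.
  apply: (mulfI N_neq0); rewrite mulrA mulfV // mul1r.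
  transitivity (\sum_n' \sum_m (beta n^-1%g m * beta m n') * y (e (f, n'))).
    rewrite exchange_big; apply: eq_bigr => m _; rewrite ffunE /= mulr_sumr.
    by apply: eq_bigr => n' _; rewrite actKV b'K mulrAC mulrA.
  under eq_bigr do rewrite -mulr_suml orth.
  rewrite (bigD1 n) //= eqxx mulr1 big1 ?addr0 => [|n' /negPf neq_n'].
    by rewrite -def_g e'K.
  by rewrite eq_sym neq_n' mulr0 mul0r.
have psi_linear : ffun_linear psi.
  split=> [x y | c x]; apply/ffunP=> p; rewrite !ffunE.
    by rewrite -big_split; apply: eq_bigr => n _; rewrite ffunE mulrDl.
  by rewrite mulr_sumr; apply: eq_bigr => n _; rewrite ffunE mulrA.
have psiM x y : psi (conv x y) = gpd_mul act (psi x) (psi y).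
  apply/ffunP=> -[l f]; rewrite !ffunE /=.
  pose H g := if f == (e' g).1 then beta (b (act l f)) (e' g).2 else 0.
  transitivity (\sum_g conv x y g * H g).
    rewrite (reindex e) /=; last by exists e' => u _; rewrite ?eK ?e'K.
    rewrite sum_pairs exchange_big; apply: eq_bigr => n _.
    rewrite -(sum_if_eq f (fun h => conv x y (e (h, n)) * beta (b (act l f)) n)).
    by apply: eq_bigr => h _; rewrite /H eK; case: ifP; rewrite ?mulr0.
  rewrite sum_conv (reindex e) /=; last by exists e' => u _; rewrite ?eK ?e'K.
  rewrite sum_pairs.
  apply: eq_bigr => h _; rewrite !ffunE /= mulr_suml; apply: eq_bigr => m _.
  rewrite (reindex e) /=; last by exists e' => u _; rewrite ?eK ?e'K.
  rewrite sum_pairs.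
  rewrite (bigD1 (h^-1 * f)%g) //= [X in _ + X]big1 ?addr0 => [|g neq_g]; last first.
    apply: big1 => n _; rewrite eM /H eK /=; case: eqP => [eq_f | _]; last by rewrite mulr0.
    by case/eqP: neq_g; rewrite eq_f mulKg.
  rewrite mulr_sumr; apply: eq_bigr => n _; rewrite eM /H eK /= mulKVg eqxx betaM.
  rewrite -actM mulKVg mulrACA; congr (_ * _ * _).
  (* Invariance under [h^-1 * f] moves the character from the target of the first arrow to the
     target of the composite. *)
  by rewrite -[RHS](beta_inv (to_inj (h^-1 * f)%g) (to_fix _)) -to_b -actM mulKVg.
exists G, phi; split.
- by exists psi.
- exact: ffun_linear_inv psi_linear psiK phiK.
- by move=> x y; rewrite -{1}(phiK x) -{1}(phiK y) -psiM psiK.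
apply: (can_inj psiK); rewrite phiK; apply/ffunP=> -[l f]; rewrite !ffunE /=.
have e1 : e (1%g, 1%g) = 1%g.
  by apply: (mulgI (e (1, 1)%g)); rewrite eM to_fix !mulg1.
rewrite (bigD1 1%g) //= big1 ?addr0 => [|n nn1]; rewrite ffunE -e1 (can_eq eK) xpair_eqE.
  by rewrite eqxx andbT betaC beta1 mulr1.
by rewrite (negPf nn1) andbF mul0r.
Qed.
End FourierTransform.

(** * Pairings invariant under all permutations fixing 1 *)

Section Pairing.
Variables (k : fieldType) (N : finGroupType) (a c : k).

(** Besides the value 1 at the identity, invariance leaves one value on the diagonal and one off it.
    In order 3 they are [w] and [w ^+ 2] for a primitive cube root of unity [w]; on the Klein group,
    1 and -1, the alternating form. *)
Definition pairing (x y : N) : k :=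
  if (x == 1%g) || (y == 1%g) then 1 else if x == y then a else c.

Lemma pairing1 x : pairing 1%g x = 1.
Proof. by rewrite /pairing eqxx. Qed.

Lemma pairingC x y : pairing x y = pairing y x.
Proof. by rewrite /pairing orbC (eq_sym x y). Qed.

Lemma pairing_eq x : x != 1%g -> pairing x x = a.
Proof. by rewrite /pairing => /negPf->; rewrite eqxx. Qed.

Lemma pairing_neq x y : x != 1%g -> y != 1%g -> x != y -> pairing x y = c.
Proof. by rewrite /pairing => /negPf-> /negPf-> /negPf->. Qed.

Lemma pairing_inv (s : N -> N) : injective s -> s 1%g = 1%g ->
  forall x y, pairing (s x) (s y) = pairing x y.
Proof.
by move=> inj_s s1 x y; rewrite /pairing -{1 2}s1 !(inj_eq inj_s).
Qed.

Lemma pairing_sum x : 1 + a + c *+ #|N|.-2 = 0 -> x != 1%g -> \sum_y pairing x y = 0.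
Proof.
move=> sum0 nx1; apply: etrans sum0; rewrite (bigD1 1%g) //= (bigD1 x) //= addrA.
rewrite pairingC pairing1 pairing_eq //; congr (_ + _).
rewrite (eq_bigr (fun=> c)) => [|y /andP[ny1 nyx]]; last first.
  by rewrite pairing_neq // eq_sym.
transitivity (\sum_(y in ~: [set 1%g; x]) c).
  by apply: eq_bigl => y; rewrite !inE negb_or.
rewrite sumr_const; congr (_ *+ _).
have := cardsC [set 1%g; x]; rewrite cards2 eq_sym nx1 => /(congr1 (fun m => m - 2)%N).
by rewrite addKn subn2 => ->.
Qed.

Lemma cover_uniq (s : seq N) : uniq s -> size s = #|N| -> forall z, z \in s.
Proof.
move=> us ss z; have /subset_leqif_cards/leqifP : [set y in s] \subset [set: N] by rewrite subsetT.
rewrite cardsT -ss cardsE (card_uniqP us); case: eqP => [eqT _ | _]; last by rewrite ltnn.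
by have := in_setT z; rewrite -eqT inE.
Qed.

End Pairing.

Section Order3.
Variable N : finGroupType.
Hypothesis oN : #|N| = 3%N.

Let cube (x : N) : (x * x * x = 1)%g.
Proof.
have := order_dvdG (in_setT x); rewrite cardsT oN order_dvdn => /eqP <-.
by rewrite !expgS expg0 mulg1 mulgA.
Qed.

Let sq_neq (x : N) : x != 1%g -> (x * x != 1)%g && (x * x != x)%g.
Proof.
move=> nx1; rewrite -{5}[x]mulg1 (inj_eq (mulgI x)) nx1 andbT.
by apply: contra nx1 => /eqP xx1; rewrite -(cube x) xx1 mul1g.
Qed.

Let key (x y : N) : x != 1%g -> y != 1%g -> y != x -> y = (x * x)%g.
Proof.
move=> nx1 ny1 nyx; have /andP[n1 n2] := sq_neq nx1.
have := @cover_uniq N [:: 1; x; x * x]%g _ _ y.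
rewrite oN !inE (negPf ny1) (negPf nyx) => H; apply/eqP/H => //=.
by rewrite !inE negb_or eq_sym nx1 eq_sym n1 eq_sym n2.
Qed.

(** The two nontrivial elements are the squares of each other, a description preserved by any
    permutation fixing 1. *)
Lemma order3_auto (s : N -> N) : injective s -> s 1%g = 1%g ->
  forall x y, s (x * y)%g = (s x * s y)%g.
Proof.
move=> inj_s s1 x y; have [-> | nx1] := eqVneq x 1%g; first by rewrite s1 !mul1g.
have [-> | ny1] := eqVneq y 1%g; first by rewrite s1 !mulg1.
have s_neq1 z : (s z == 1%g) = (z == 1%g) by rewrite -{1}s1 (inj_eq inj_s).
have [-> | nyx] := eqVneq y x.
  by have /andP[n1 n2] := sq_neq nx1; apply: key; rewrite ?s_neq1 ?(inj_eq inj_s).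
rewrite (key nx1 ny1 nyx) mulgA cube s1.
have /andP[n1 n2] := sq_neq nx1.
by rewrite (@key (s x) (s (x * x)%g)) ?s_neq1 ?(inj_eq inj_s) // mulgA cube.
Qed.

Lemma order3_pairingM (k : fieldType) (w : k) : w ^+ 2 + w + 1 = 0 ->
  forall x y z : N, pairing w (w ^+ 2) x (y * z)%g =
    pairing w (w ^+ 2) x y * pairing w (w ^+ 2) x z.
Proof.
move=> w_root; have w3 : w * w * w = 1.
  apply/eqP; rewrite -subr_eq0; apply/eqP.
  by transitivity ((w - 1) * (w ^+ 2 + w + 1)); [ring | rewrite w_root mulr0].
move=> x y z; have [-> | nx1] := eqVneq x 1%g; first by rewrite !pairing1 mulr1.
have p1 u : pairing w (w ^+ 2) u (1%g : N) = 1 by rewrite pairingC pairing1.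
have [-> | ny1] := eqVneq y 1%g; first by rewrite p1 !mul1g mul1r.
have [-> | nz1] := eqVneq z 1%g; first by rewrite p1 !mulg1 mulr1.
have /andP[n1 n2] := sq_neq nx1.
have pxx : pairing w (w ^+ 2) x (x * x)%g = w ^+ 2.
  by rewrite pairing_neq // eq_sym.
have xy4 : (x * x * (x * x) = x)%g by rewrite mulgA cube mul1g.
have [-> | /(key nx1 ny1) ->] := eqVneq y x; have [-> | /(key nx1 nz1) ->] := eqVneq z x;
  rewrite ?xy4 ?pxx ?pairing_eq // ?(mulgA x x x) ?cube ?p1 ?pxx ?pairing_eq //; ring: w3.
Qed.
End Order3.

Section Klein.
Variable N : finGroupType.
Hypotheses (oN : #|N| = 4%N) (N2 : forall x : N, (x * x = 1)%g).

Let prod_neq (x y : N) : x != 1%g -> y != 1%g -> x != y ->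
  [/\ x * y != 1, x * y != x & x * y != y]%g.
Proof.
move=> nx1 ny1 nxy; split.
- by rewrite -(N2 x) (inj_eq (mulgI x)) eq_sym.
- by rewrite -{2}[x]mulg1 (inj_eq (mulgI x)).
by rewrite -{2}[y]mul1g (inj_eq (mulIg y)).
Qed.

Let key (x y z : N) : x != 1%g -> y != 1%g -> x != y ->
  z != 1%g -> z != x -> z != y -> z = (x * y)%g.
Proof.
move=> nx1 ny1 nxy nz1 nzx nzy; have [n1 n2 n3] := prod_neq nx1 ny1 nxy.
have := @cover_uniq N [:: 1; x; y; x * y]%g _ _ z.
rewrite oN !inE (negPf nz1) (negPf nzx) (negPf nzy) => H; apply/eqP/H => //=.
rewrite !inE !negb_or ![1%g == _]eq_sym nx1 ny1 n1 nxy.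
by rewrite [x == _]eq_sym n2 [y == _]eq_sym n3.
Qed.

(** The product of two distinct nontrivial elements is the third one, which permutations fixing 1
    respect. *)
Lemma klein_auto (s : N -> N) : injective s -> s 1%g = 1%g ->
  forall x y, s (x * y)%g = (s x * s y)%g.
Proof.
move=> inj_s s1 x y; have [-> | nx1] := eqVneq x 1%g; first by rewrite s1 !mul1g.
have [-> | ny1] := eqVneq y 1%g; first by rewrite s1 !mulg1.
have s_neq1 z : (s z == 1%g) = (z == 1%g) by rewrite -{1}s1 (inj_eq inj_s).
have [-> | nxy] := eqVneq x y; first by rewrite !N2 s1.
have [n1 n2 n3] := prod_neq nx1 ny1 nxy.
by apply: key; rewrite ?s_neq1 ?(inj_eq inj_s).
Qed.

Lemma klein_pairingM (k : fieldType) (x y z : N) :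
  pairing (1 : k) (-1) x (y * z)%g = pairing 1 (-1) x y * pairing 1 (-1) x z.
Proof.
have [-> | nx1] := eqVneq x 1%g; first by rewrite !pairing1 mulr1.
have p1 u : pairing (1 : k) (-1) u (1%g : N) = 1 by rewrite pairingC pairing1.
have [-> | ny1] := eqVneq y 1%g; first by rewrite p1 !mul1g mul1r.
have [-> | nz1] := eqVneq z 1%g; first by rewrite p1 !mulg1 mulr1.
have [-> | nyz] := eqVneq y z.
  rewrite N2 p1; have [<- | nxz] := eqVneq x z; first by rewrite pairing_eq // mulr1.
  by rewrite pairing_neq // mulrNN mulr1.
have [n1 n2 n3] := prod_neq ny1 nz1 nyz.
have [-> | nxy] := eqVneq x y.
  by rewrite (pairing_eq _ _ ny1) !pairing_neq ?mul1r // eq_sym.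
have [-> | nxz] := eqVneq x z.
  by rewrite (pairing_eq _ _ nz1) !pairing_neq ?mulr1 // eq_sym.
rewrite (key ny1 nz1 nyz nx1 nxy nxz) pairing_eq //.
by rewrite !pairing_neq // mulrNN mulr1.
Qed.
End Klein.

Section SmallOrbit.
Variables (k : closedFieldType) (X : finType) (S : finGroupType) (act : X -> S -> X).
Hypothesis k0 : [pchar k] =i pred0.
Hypotheses (act1 : forall x, act x 1%g = x).
Hypothesis actM : forall x g h, act x (g * h)%g = act (act x g) h.
Variable x0 : X.
Hypothesis fix0 : forall g, act x0 g = x0.

Lemma pointed_bijection (N : finGroupType) : #|X| = #|N| ->
  exists (b : X -> N) (b' : N -> X), [/\ cancel b b', cancel b' b & b x0 = 1%g].
Proof.
move=> eqXN; pose f x : N := enum_val (cast_ord eqXN (enum_rank x)).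
pose f' n : X := enum_val (cast_ord (esym eqXN) (enum_rank n)).
have fK : cancel f f' by move=> x; rewrite /f /f' enum_valK cast_ordK enum_rankK.
have f'K : cancel f' f by move=> n; rewrite /f /f' enum_valK cast_ordKV enum_rankK.
(* An arbitrary bijection is translated so that [x0] goes to 1. *)
exists (fun x => (f x0)^-1 * f x)%g, (fun n => f' (f x0 * n)%g).
by split=> [x | n |]; rewrite ?mulKVg ?f'K ?fK ?mulKg ?mulVg.
Qed.

Lemma small_gpd_group_algebra : #|X| = 3%N \/ #|X| = 4%N ->
  exists (G : finGroupType) (phi : {ffun X * S -> k} -> {ffun G -> k}),
    [/\ bijective phi, ffun_linear phi,
        forall x y, phi (gpd_mul act x y) = conv (phi x) (phi y)
      & phi (gpd_one X S k) = delta k (1%g : G)].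
Proof.
case=> oX.
  pose N : finGroupType := 'Z_3; have oN : #|N| = 3%N by rewrite card_ord.
  have [b [b' [bK b'K bx0]]] := pointed_bijection (etrans oX (esym oN)).
  have /closed_rootP[w] : size ('X^2 + 'X + 1 : {poly k}) != 1.
    by rewrite -addrA size_polyDl ?size_polyXn // -[1]/(1%:P) size_XaddC.
  rewrite /root !hornerE => /eqP w_root.
  apply: (fourier_group_algebra (beta := @pairing k N w (w ^+ 2)) k0
    _ _ _ _ _ _ act1 actM fix0 bK b'K bx0).
  - exact: order3_auto.
  - exact: pairing_inv.
  - exact: pairingC.
  - exact: order3_pairingM.
  - exact: pairing1.
  by move=> x; apply: pairing_sum; rewrite oN /= mulr1n; apply: etrans w_root; ring.
pose N : finGroupType := ('Z_2 * 'Z_2)%type.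
have oN : #|N| = 4%N by rewrite card_prod !card_ord.
have N2 (x : N) : (x * x = 1)%g.
  by case: x => -[[|[|//]] ?] [[|[|//]] ?]; congr (_, _); apply: val_inj.
have [b [b' [bK b'K bx0]]] := pointed_bijection (etrans oX (esym oN)).
apply: (fourier_group_algebra (beta := @pairing k N 1 (-1)) k0
  _ _ _ _ _ _ act1 actM fix0 bK b'K bx0).
- exact: klein_auto.
- exact: pairing_inv.
- exact: pairingC.
- exact: klein_pairingM.
- exact: pairing1.
by move=> x; apply: pairing_sum; rewrite oN /= mulNrn -mulr2n subrr.
Qed.
End SmallOrbit.

(** * The bismash product of a Singer cycle *)

Lemma card_finField_prime_power (F : finFieldType) :
  exists p h, prime p /\ #|F| = (p ^ h)%N.
Proof.
have [p p_pr charF] := finPcharP F.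
by exists p, (logn p #|F|); split; last exact: (card_pprimeChar charF).
Qed.

Section SingerBismash.
Variables (F : finFieldType) (v : 'rV[F]_2) (K : {group {'GL_2[F]}}).
Hypotheses (nzv : v != 0) (cycK : cyclic K) (oK : #|K| = (#|F| ^ 2 - 1)%N).
Local Notation Z := (scalarsGL F).
Let C : {group PGL2 F} := (K / Z)%G.
Let S : {group PGL2 F} := (pointGL v / Z)%G.
Let tiCS : (C :&: S = 1)%g := singer_TI nzv cycK oK.
Let defG : (S * C = [set: PGL2 F])%g := singer_factor nzv cycK oK.
Let x0 : lpoint C := exist _ 1%g (group1 C).

Lemma singer_fix0 g : lact x0 (g : [subg S]) = x0.
Proof. by apply/eqP; rewrite (lact_fix tiCS defG) /= mul1g invg1 mulg1 subgP. Qed.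

Lemma card_singer_points : #|lpoint C| = #|F|.+1.
Proof. by rewrite card_sub -(card_singer nzv cycK oK); apply: eq_card. Qed.

(** The frame consists of [v] and its image under a lift of [x]. In these coordinates, which change
    with [x], the stabilizer of [x] is the group of all [P a 0], visibly abelian of order q - 1. *)
Lemma singer_stab (x : lpoint C) : x != x0 ->
  exists P : F -> F -> [subg S], affine_param P /\
    forall a b, a != 0 -> (lact x (P a b) == x) = (b == 0).
Proof.
case: x => _c Cc nx0; have /morphimP[l _ Kl def_c] := Cc; subst.
have wNv : ~~ (v *m GLval l <= v)%MS.
  by apply: (singer_orbit nzv cycK oK Kl); rewrite -val_eqE in nx0.
exists (fun a b => subg S (affPGL v (v *m GLval l) a b)).
split; first exact: (affPGL_param nzv wNv).
move=> a b nza; rewrite (lact_fix tiCS defG) /=.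
have := affPGL_conj nzv wNv b nza (erefl _).
by rewrite (subgK _ (affPGL_mem nzv wNv b nza)).
Qed.

Lemma singer_not_group_algebra (k : fieldType) : [pchar k] =i pred0 -> (3 < #|F|)%N ->
  ~ bismash_is_group_algebra k C S.
Proof.
move=> k0 q_gt3 /(bismash_group_algebraP tiCS defG)[G [phi [bij_phi lphi phiM phi1]]].
have [p [h [p_pr def_q]]] := card_finField_prime_power F.
have [w wNv] := exists_frame nzv.
have affS := affPGL_param nzv wNv.
have [r oF] : exists r, #|F| = r.+1 by case: #|F| q_gt3 => // r; exists r.
have r_gt0 : (0 < r)%N by move: q_gt3; rewrite oF; case: (r).
apply: (affine_not_group_algebra (lact1 tiCS defG) (lactM tiCS defG)
  (V := translations_group affS) r_gt0 singer_fix0 _ _ _ _ _ _ k0 bij_phi lphi phiM phi1 p_pr).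
- by rewrite (affine_card affS) oF.
- by rewrite card_singer_points oF.
- by rewrite (card_translations affS) oF.
- move=> x g g' nx0; have [P [affP fixP]] := singer_stab nx0.
  have [surjP _ _] := affP.
  have [a [b [nza ->]]] := surjP g; have [a' [b' [nza' ->]]] := surjP g'.
  move=> /eqP; rewrite fixP // => /eqP-> /eqP; rewrite fixP // => /eqP->.
  exact: affine_commutes.
- move=> x nx0; have [P [affP fixP]] := singer_stab nx0.
  rewrite -sum1_card big_mkcond (affine_sum affP).
  transitivity (\sum_(a : F | a != 0%R) 1)%N; last by rewrite sum_neq0 oF.
  apply: eq_bigr => a nza; rewrite (bigD1 0) //= inE fixP // eqxx big1 // => b nb.
  by rewrite inE fixP // (negPf nb).
- by move=> t; rewrite (affine_ncomm affS) oF.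
- by rewrite -oF; apply: def_q.
by rewrite -oF.
Qed.

Lemma singer_small_group_algebra (k : closedFieldType) : [pchar k] =i pred0 ->
  #|F| = 2%N \/ #|F| = 3%N -> bismash_is_group_algebra k C S.
Proof.
move=> k0 oF; apply/(bismash_group_algebraP tiCS defG).
apply: (small_gpd_group_algebra k0 (lact1 tiCS defG) (lactM tiCS defG) singer_fix0).
by rewrite card_singer_points; case: oF => ->; [left | right].
Qed.
End SingerBismash.

Local Close Scope ring_scope.

Theorem theoremA (k : closedFieldType) (F : finFieldType)
  (C S : {set PGL2 F}) :
  [pchar k]%R =i pred0 ->
  singer_cycle C ->
  point_stabilizer S ->
  (bismash_is_group_algebra k C S <-> (#|F| = 2 \/ #|F| = 3)).
Proof.
move=> k0 [K [cycK oK ->]] [v [nzv ->]]; split=> [isG | oF]; last first.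
  exact: (singer_small_group_algebra nzv cycK oK k0 oF).
have q_gt1 : (1 < #|F|)%N := finNzRing_gt1 F.
case: (ltngtP #|F| 3) => [q_lt3 | q_gt3 | ->]; [left | | by right].
  by apply/eqP; rewrite eqn_leq -ltnS q_lt3.
by case: (singer_not_group_algebra nzv cycK oK k0 q_gt3 isG).
Qed.
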